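(* Let $\mathbf{B}$ be a Mal'cev algebra on a three-element set. Then $\mathbf{B}$ is isomorphic to an algebra $\mathbf{A}$ with universe $\{0,1,2\}$ and monolith $\mu$ such that either (1) $\mu=1_A$, and $\mathrm{Clo}(\mathbf{A})=\mathrm{Pol}(\Gamma)$ where $\Gamma$ consists of all subuniverses of $\mathbf{A}$ together with $$\{\varphi,\psi_2,\psi_0',\psi_1',\psi_2',\varphi_0',\ldots,\varphi_5',T,T_0',T_1',T_2'\}\cap\mathrm{Inv}(\mathbf{A});$$ or (2) $\mu=\mu_2$, and $\mathrm{Clo}(\mathbf{A})=\mathrm{Pol}(\Gamma)$ where $\Gamma$ consists of all subuniverses of $\mathbf{A}$ together with $$\{\mu_2,\rho_2,\tau_0,\tau_1,\psi_2,\psi_2',T_2,T_2',T^{\mu_2},S_{01}\}\cap\mathrm{Inv}(\mathbf{A}).$$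
   Context: A Mal'cev algebra is an algebra with a term operation $d$ satisfying $d(y,x,x)\approx d(x,x,y)\approx y$. $\mathrm{Clo}(\mathbf{A})$ is the clone of term operations of $\mathbf{A}$; $\mathrm{Inv}(\mathbf{A})$ is the set of all relations on $A$ preserved by all operations of $\mathbf{A}$; $\mathrm{Pol}(\Gamma)$ is the clone of operations preserving all relations in $\Gamma$. A subuniverse is a (unary) subset closed under the operations. The monolith of $\mathbf{A}$ is the least congruence strictly above the equality relation $0_A$ (equal to $1_A=A^2$ when $\mathbf{A}$ is simple). Relations on $\{0,1,2\}$: $\mu_i$ is the equivalence relation with classes $\{i\}$ and $\{0,1,2\}\setminus\{i\}$; $\rho_i=\{0,1,2\}^2\setminus\mu_i$; $\psi_i$ is the graph of the transposition of $\{0,1,2\}$ fixing $i$, and $\psi_i'$ is its restriction to $\{0,1,2\}\setminus\{i\}$ (e.g. $\psi_2=\{(0,1),(1,0),(2,2)\}$, $\psi_2'=\{(0,1),(1,0)\}$); $\varphi=\{(0,1),(1,2),(2,0)\}$; $\varphi_0'=\{(1,2),(2,0)\}$, $\varphi_1'=\{(0,1),(2,0)\}$, $\varphi_2'=\{(0,1),(1,2)\}$, $\varphi_3'=\{(1,2),(0,0)\}$, $\varphi_4'=\{(0,2),(1,1)\}$, $\varphi_5'=\{(0,1),(2,2)\}$; $\tau_0=\{(0,0),(1,0),(2,1)\}$, $\tau_1=\{(0,1),(1,1),(2,0)\}$. Let $\mathrm{min}$ denote the minority operation on a two-element set ($\mathrm{min}(x,y,y)=\mathrm{min}(y,x,y)=\mathrm{min}(y,y,x)=x$).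 Then $T=\{(x,y,z,x-y+z\bmod 3):x,y,z\in\{0,1,2\}\}$; $T_i'=\{(x,y,z,\mathrm{min}(x,y,z)):x,y,z\in\{0,1,2\}\setminus\{i\}\}$; $T_i=T_i'\cup\{(i,i,i,i)\}$; $T^{\mu_2}=\{(x,y,z,u):u/\mu_2=\mathrm{min}(x/\mu_2,y/\mu_2,z/\mu_2)\}$ (minority on the two $\mu_2$-classes); and $S_{01}=\{(0,0,0),(0,0,1),(1,1,0),(1,1,1),(0,1,2),(1,0,2)\}$. *)

(* Defs.v *)
From mathcomp Require Import all_boot.
Set Implicit Arguments. Unset Strict Implicit. Unset Printing Implicit Defensive.

(* n-ary operation on a finite set T, as a finite function (so extensional
   equality of operations is Leibniz equality). *)
Definition op (T : finType) (n : nat) := {ffun {ffun 'I_n -> T} -> T}.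

Definition rel_on (T : finType) (m : nat) := {set {ffun 'I_m -> T}}.

Definition anyrel (T : finType) := {m : nat & rel_on T m}.

Section Algebra.
Variables (T : finType) (I : Type) (ar : I -> nat) (ops : forall i, op T (ar i)).

Inductive clo (n : nat) : op T n -> Prop :=
| clo_proj (k : 'I_n) : clo [ffun x : {ffun 'I_n -> T} => x k]
| clo_comp (i : I) (g : 'I_(ar i) -> op T n) :
    (forall k, clo (g k)) -> clo [ffun x : {ffun 'I_n -> T} => ops i [ffun k => g k x]].

Definition preserves n m (f : op T n) (R : rel_on T m) : Prop :=
  forall rows : {ffun 'I_n -> {ffun 'I_m -> T}},
    (forall j, rows j \in R) -> [ffun i => f [ffun j => rows j i]] \in R.

Definition Inv m (R : rel_on T m) : Prop := forall i, preserves (ops i) R.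

Definition Pol (Gamma : anyrel T -> Prop) n (f : op T n) : Prop :=
  forall R : anyrel T, Gamma R -> preserves f (projT2 R).

Definition subuniverse (S : {set T}) : Prop :=
  forall i (x : {ffun 'I_(ar i) -> T}), (forall k, x k \in S) -> ops i x \in S.

Definition unary_rel (S : {set T}) : rel_on T 1 := [set x : {ffun 'I_1 -> T} | x ord0 \in S].

Definition Gamma_of (L : seq (anyrel T)) (R : anyrel T) : Prop :=
  (exists2 S, subuniverse S & R = existT _ 1 (unary_rel S))
  \/ (R \in L /\ Inv (projT2 R)).

Definition eq_rel : rel_on T 2 := [set x : {ffun 'I_2 -> T} | x ord0 == x (@Ordinal 2 1 isT)].
Definition full_rel : rel_on T 2 := setT.
Definition pair_of (a b : T) : {ffun 'I_2 -> T} := [ffun j : 'I_2 => nth a [:: a; b] j].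

Definition congruence (th : rel_on T 2) : Prop :=
  [/\ forall a, pair_of a a \in th,
      forall a b, pair_of a b \in th -> pair_of b a \in th,
      forall a b c, pair_of a b \in th -> pair_of b c \in th -> pair_of a c \in th
    & Inv th].

Definition is_monolith (mu : rel_on T 2) : Prop :=
  [/\ congruence mu, mu != eq_rel &
      forall th, congruence th -> th != eq_rel -> mu \subset th].

Definition triple_of (a b c : T) : {ffun 'I_3 -> T} :=
  [ffun j : 'I_3 => nth a [:: a; b; c] j].

Definition malcev : Prop :=
  exists2 d : op T 3, clo d &
    forall x y, d (triple_of y x x) = y /\ d (triple_of x x y) = y.

End Algebra.

Definition I3 := 'I_3.

Definition rel_list (m : nat) (l : seq (seq nat)) : rel_on 'I_3 m :=
  [set x : {ffun 'I_m -> 'I_3} | [seq nat_of_ord (x i) | i <- enum 'I_m] \in l].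

Definition mk (m : nat) (R : rel_on 'I_3 m) : anyrel 'I_3 := existT _ m R.

Definition minority (T : eqType) (x y z : T) : T :=
  if x == y then z else if x == z then y else x.

Definition v (m : nat) (x : {ffun 'I_m -> 'I_3}) (k : nat) : nat :=
  nth 0 [seq nat_of_ord (x i) | i <- enum 'I_m] k.

Definition mu_ (i : nat) : rel_on 'I_3 2 := [set x : {ffun 'I_2 -> 'I_3} | (v x 0 == i) == (v x 1 == i)].
Definition rho_ (i : nat) : rel_on 'I_3 2 := ~: mu_ i.

Definition psi0 := rel_list 2 [:: [:: 0; 0]; [:: 1; 2]; [:: 2; 1]].
Definition psi1 := rel_list 2 [:: [:: 1; 1]; [:: 0; 2]; [:: 2; 0]].
Definition psi2 := rel_list 2 [:: [:: 0; 1]; [:: 1; 0]; [:: 2; 2]].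
Definition psi0' := rel_list 2 [:: [:: 1; 2]; [:: 2; 1]].
Definition psi1' := rel_list 2 [:: [:: 0; 2]; [:: 2; 0]].
Definition psi2' := rel_list 2 [:: [:: 0; 1]; [:: 1; 0]].
Definition phi := rel_list 2 [:: [:: 0; 1]; [:: 1; 2]; [:: 2; 0]].
Definition phi0' := rel_list 2 [:: [:: 1; 2]; [:: 2; 0]].
Definition phi1' := rel_list 2 [:: [:: 0; 1]; [:: 2; 0]].
Definition phi2' := rel_list 2 [:: [:: 0; 1]; [:: 1; 2]].
Definition phi3' := rel_list 2 [:: [:: 1; 2]; [:: 0; 0]].
Definition phi4' := rel_list 2 [:: [:: 0; 2]; [:: 1; 1]].
Definition phi5' := rel_list 2 [:: [:: 0; 1]; [:: 2; 2]].
Definition tau0 := rel_list 2 [:: [:: 0; 0]; [:: 1; 0]; [:: 2; 1]].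
Definition tau1 := rel_list 2 [:: [:: 0; 1]; [:: 1; 1]; [:: 2; 0]].

(* T = {(x,y,z,x-y+z mod 3)} *)
Definition Trel : rel_on 'I_3 4 :=
  [set x : {ffun 'I_4 -> 'I_3} | v x 3 == (v x 0 + 2 * v x 1 + v x 2) %% 3].
Definition T'_ (i : nat) : rel_on 'I_3 4 :=
  [set x : {ffun 'I_4 -> 'I_3} | [&& v x 0 != i, v x 1 != i, v x 2 != i &
              v x 3 == minority (v x 0) (v x 1) (v x 2)]].
Definition T_ (i : nat) : rel_on 'I_3 4 :=
  T'_ i :|: [set x : {ffun 'I_4 -> 'I_3} | [&& v x 0 == i, v x 1 == i, v x 2 == i & v x 3 == i]].
(* T^{mu_2}: the mu_2-classes are {2} and {0,1}; class of x encoded by (x == 2) *)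
Definition Tmu2 : rel_on 'I_3 4 :=
  [set x : {ffun 'I_4 -> 'I_3} | (v x 3 == 2) == minority (v x 0 == 2) (v x 1 == 2) (v x 2 == 2)].
Definition S01 := rel_list 3
  [:: [:: 0; 0; 0]; [:: 0; 0; 1]; [:: 1; 1; 0]; [:: 1; 1; 1]; [:: 0; 1; 2]; [:: 1; 0; 2]].

Definition list1 : seq (anyrel 'I_3) :=
  [:: mk phi; mk psi2; mk psi0'; mk psi1'; mk psi2';
      mk phi0'; mk phi1'; mk phi2'; mk phi3'; mk phi4'; mk phi5';
      mk Trel; mk (T'_ 0); mk (T'_ 1); mk (T'_ 2)].

Definition list2 : seq (anyrel 'I_3) :=
  [:: mk (mu_ 2); mk (rho_ 2); mk tau0; mk tau1; mk psi2; mk psi2';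
      mk (T_ 2); mk (T'_ 2); mk Tmu2; mk S01].

(* Main.v *)
Require Import Defs.
From mathcomp Require Import all_boot perm.
From mathcomp Require Import boolp.

Set Implicit Arguments.
Unset Strict Implicit.
Unset Printing Implicit Defensive.

(** Let [f] preserve [Gamma]. By the Galois connection between operations and
    relations it suffices that [f] preserves every invariant relation [R] of the
    algebra, and this is shown by induction on the arity. If the image [t] of
    some tuples of [R] is not in [R], the induction hypothesis provides, for
    every coordinate [z], a tuple of [R] that differs from [t] at [z] only. The
    Mal'cev operation then makes each coordinate a fork algebra [B_z / th_z] with
    at least two elements, where [th_z] collects the pairs of values occurring at
    [z] in tuples equal elsewhere. In arity at least 3 these quotients turn out
    to be abelian: either two-element algebras on which the Mal'cev operation is
    the minority, or all of Z_3, or all of [A] with an abelian monolith whose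
    classes are shared by all coordinates. In each case the relation [sim j l]
    between pairs of coordinates that fit the same remaining tuple is controlled
    by a listed relation ([T], [T'_i], [T_2], [T^mu_2] or [S_01]). Hence [f]
    preserves [sim j l], so all given tuples may be modified at [j] and [l] until
    coordinate [j] is redundant, and the induction hypothesis applies. In arity 2,
    [R] is an isomorphism between subquotients of [A], which is listed up to
    composition, inverse and choice of the labelling of [A]. *)

(** * Preservation and the Galois connection *)

Section Preservation.
Variables (T : finType) (n : nat) (g : op T n).

(* A relation is a predicate on [K -> T] for an arbitrary index type [K], so
   that dropping a coordinate needs no reindexing. *)
Definition prs (K : Type) (P : (K -> T) -> Prop) : Prop :=
  forall rows : 'I_n -> K -> T,
    (forall j, P (rows j)) -> P (fun k => g [ffun j => rows j k]).

Definition pr1 (P : T -> Prop) : Prop :=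
  forall x : 'I_n -> T, (forall j, P (x j)) -> P (g [ffun j => x j]).

Definition pr2 (P : T -> T -> Prop) : Prop :=
  forall x y : 'I_n -> T, (forall j, P (x j) (y j)) ->
    P (g [ffun j => x j]) (g [ffun j => y j]).

Definition pr3 (P : T -> T -> T -> Prop) : Prop :=
  forall x y z : 'I_n -> T, (forall j, P (x j) (y j) (z j)) ->
    P (g [ffun j => x j]) (g [ffun j => y j]) (g [ffun j => z j]).

Definition pr4 (P : T -> T -> T -> T -> Prop) : Prop :=
  forall x y z u : 'I_n -> T, (forall j, P (x j) (y j) (z j) (u j)) ->
    P (g [ffun j => x j]) (g [ffun j => y j])
      (g [ffun j => z j]) (g [ffun j => u j]).

Lemma prs_unit P : prs (fun r : unit -> T => P (r tt)) <-> pr1 P.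
Proof.
by split=> H; [move=> x Px; apply: (H (fun j _ => x j)) | move=> rows Pr; apply: H].
Qed.

Lemma prs_bool P : prs (fun r : bool -> T => P (r true) (r false)) <-> pr2 P.
Proof.
split=> H; last by move=> rows Pr; apply: H.
by move=> x y Pxy; apply: (H (fun j b => if b then x j else y j)).
Qed.

Lemma pr2_sym P : pr2 P -> pr2 (fun x y => P y x).
Proof. by move=> H x y Pxy; apply: H. Qed.

Lemma pr2_comp (P Q : T -> T -> Prop) :
  pr2 P -> pr2 Q -> pr2 (fun x z => exists y, P x y /\ Q y z).
Proof.
move=> HP HQ x z /choice[y Hy]; exists (g [ffun j => y j]).
by split; [apply: HP | apply: HQ] => j; have [] := Hy j.
Qed.

Lemma pr2_eq : pr2 (@eq T).
Proof. by move=> x y /funext->. Qed.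

End Preservation.

Section Closed.
Variables (T : finType) (I : Type) (ar : I -> nat) (ops : forall i, op T (ar i)).

Definition clK (K : Type) (P : (K -> T) -> Prop) := forall i, prs (ops i) P.
Definition cl1 P := forall i, pr1 (ops i) P.
Definition cl2 P := forall i, pr2 (ops i) P.
Definition cl3 P := forall i, pr3 (ops i) P.
Definition cl4 P := forall i, pr4 (ops i) P.

Lemma clo_prs (K : Type) (P : (K -> T) -> Prop) n (g : op T n) :
  clK P -> clo ops g -> prs g P.
Proof.
move=> clP; elim=> {g} [k|i g _ IH] rows Pr.
  suff -> : (fun k0 => [ffun x : {ffun 'I_n -> T} => x k] [ffun j => rows j k0]) =
            rows k by [].
  by apply/funext=> k0; rewrite !ffunE.
have := clP i (fun j k => g j [ffun l => rows l k]) (fun j => IH j rows Pr).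
by congr P; apply/funext=> k; rewrite ffunE.
Qed.

(** Index tuples by the inputs of [f]: the n-ary term operations, read as such tuples, form an
    invariant relation containing the projections. Applying [f] to the projections returns [f]
    itself, which is therefore a term operation. *)
Lemma clo_of_prs n (f : op T n) :
  (forall (K : finType) (P : (K -> T) -> Prop), clK P -> prs f P) ->
  clo ops f.
Proof.
pose P (r : {ffun 'I_n -> T} -> T) := exists2 g : op T n, clo ops g & forall x, r x = g x.
move=> /(_ _ P) H.
have clP : clK P.
  move=> i rows /(_ _)/cid2 Pr.
  pose g j := s2val (Pr j).
  exists [ffun x : {ffun 'I_n -> T} => ops i [ffun k => g k x]].
    by apply: clo_comp => k; rewrite /g; case: (Pr k).
  move=> x; rewrite ffunE; congr (ops i _); apply/ffunP=> j; rewrite !ffunE /g.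
  by case: (Pr j).
have [|g clg gE] := H clP (fun j x => x j).
  move=> j; exists [ffun x : {ffun 'I_n -> T} => x j]; first exact: clo_proj.
  by move=> x; rewrite ffunE.
suff -> : f = g by [].
apply/ffunP=> x; rewrite -gE; congr (f _).
by apply/ffunP=> j; rewrite ffunE.
Qed.

Lemma clo_malcev (d : op T 3) : clo ops d ->
  forall (K : finType) (P : (K -> T) -> Prop), clK P ->
  forall r1 r2 r3, P r1 -> P r2 -> P r3 ->
  P (fun k => d (triple_of (r1 k) (r2 k) (r3 k))).
Proof.
move=> cd K P clP r1 r2 r3 P1 P2 P3.
by apply: (clo_prs clP cd (rows := fun j k => nth (r1 k) [:: r1 k; r2 k; r3 k] j))
  => -[[|[|[|//]]] j3].
Qed.

End Closed.

(** * Fork congruences *)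

Section Fork.
Variables (T : finType) (K : finType) (R : (K -> T) -> Prop).
Variable D : T -> T -> T -> T.
Hypothesis D1 : forall x y, D y x x = y.
Hypothesis D2 : forall x y, D x x y = y.
Hypothesis RD : forall r1 r2 r3, R r1 -> R r2 -> R r3 ->
  R (fun k => D (r1 k) (r2 k) (r3 k)).

Definition upd (r : K -> T) z x : K -> T := fun k => if k == z then x else r k.
Definition upd2 r j l x y := upd (upd r j x) l y.

Lemma upd_eq r z x : upd r z x z = x. Proof. by rewrite /upd eqxx. Qed.
Lemma upd_neq r z x k : k != z -> upd r z x k = r k.
Proof. by rewrite /upd => /negbTE->. Qed.
Lemma upd_id r z : upd r z (r z) = r.
Proof. by apply/funext=> k; rewrite /upd; case: eqP => [->|]. Qed.
Lemma updC r j l x y : j != l -> upd (upd r j x) l y = upd (upd r l y) j x.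
Proof.
move=> jl; apply/funext=> k; rewrite /upd.
by case: (k =P l) => [->|//]; rewrite eq_sym (negbTE jl).
Qed.
Lemma upd2C r j l x y : j != l -> upd2 r j l x y = upd2 r l j y x.
Proof. exact: updC. Qed.
Lemma upd2_1 r j l x y : j != l -> upd2 r j l x y j = x.
Proof. by move=> jl; rewrite /upd2 upd_neq // upd_eq. Qed.
Lemma upd2_2 r j l x y : upd2 r j l x y l = y.
Proof. by rewrite /upd2 upd_eq. Qed.
Lemma upd2_neq r j l x y k : k != j -> k != l -> upd2 r j l x y k = r k.
Proof. by move=> kj kl; rewrite /upd2 !upd_neq. Qed.
Lemma upd2_id r j l : upd2 r j l (r j) (r l) = r.
Proof. by rewrite /upd2 upd_id upd_id. Qed.
Lemma updE r s z : (forall k, k != z -> r k = s k) -> upd r z (s z) = s.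
Proof. by move=> H; apply/funext=> k; rewrite /upd; case: eqP => [->|/eqP/H]. Qed.
Lemma upd2E r s j l : (forall k, k != j -> k != l -> r k = s k) ->
  upd2 r j l (s j) (s l) = s.
Proof.
move=> H; apply/funext=> k; rewrite /upd2 /upd.
by case: (k =P l) => [->//|/eqP kl]; case: (k =P j) => [->//|/eqP kj]; apply: H.
Qed.

Definition th z x y := exists r, R (upd r z x) /\ R (upd r z y).
Definition sim j l x y x' y' := exists r, R (upd2 r j l x y) /\ R (upd2 r j l x' y').
(** The projection of [R] to coordinate [z], written as the domain of [th z] so that it inherits
    preservation from [th z]. *)
Definition Bs z x := th z x x.

Lemma Bs_of r z : R r -> Bs z (r z).
Proof. by move=> Rr; exists r; rewrite upd_id. Qed.
Lemma Bs_upd r z x : R (upd r z x) -> Bs z x.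
Proof. by exists r. Qed.
Lemma Bs_ex z x : Bs z x -> exists2 r, R r & r z = x.
Proof. by case=> r [Rr _]; exists (upd r z x); rewrite ?upd_eq. Qed.

Lemma th_sym z x y : th z x y -> th z y x.
Proof. by case=> r [? ?]; exists r. Qed.

Lemma th_Bl z x y : th z x y -> Bs z x.
Proof. by case=> r [? ?]; exists r. Qed.
Lemma th_Br z x y : th z x y -> Bs z y.
Proof. by move/th_sym/th_Bl. Qed.

(** A fork over one tuple can be copied to any other: [D] applied to the given tuple and the two
    forking ones restores the given tuple off [z] and yields [D x x y = y] at [z]. *)
Lemma th_upd r z x y : R (upd r z x) -> th z x y -> R (upd r z y).
Proof.
move=> Rx [s [Sx Sy]]; have := RD Rx Sx Sy; congr R.
by apply/funext=> k; rewrite /upd; case: eqP => // _; rewrite ?D1 ?D2.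
Qed.

Lemma th_sub r z y : R r -> th z (r z) y -> R (upd r z y).
Proof. by move=> Rr; apply: th_upd; rewrite upd_id. Qed.

Lemma th_trans z x y w : th z x y -> th z y w -> th z x w.
Proof. by case=> r [Rx Ry] /(th_upd Ry) Rw; exists r. Qed.

Lemma sim_sym j l x y x' y' : sim j l x y x' y' -> sim j l x' y' x y.
Proof. by case=> r [? ?]; exists r. Qed.

Lemma sim_upd r j l x y x' y' :
  R (upd2 r j l x y) -> sim j l x y x' y' -> R (upd2 r j l x' y').
Proof.
move=> Rx [s [Sx Sy]]; have := RD Rx Sx Sy; congr R.
apply/funext=> k; rewrite /upd2 /upd; case: eqP => _; first by rewrite D2.
by case: eqP => _; rewrite ?D1 ?D2.
Qed.

Lemma sim_sub r j l x' y' : R r -> sim j l (r j) (r l) x' y' -> R (upd2 r j l x' y').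
Proof. by move=> Rr; apply: sim_upd; rewrite upd2_id. Qed.

Lemma sim_trans j l x y x' y' x'' y'' :
  sim j l x y x' y' -> sim j l x' y' x'' y'' -> sim j l x y x'' y''.
Proof. by case=> r [Rx Ry] /(sim_upd Ry) Rw; exists r. Qed.

Lemma sim_of r s j l : R r -> R s -> (forall k, k != j -> k != l -> r k = s k) ->
  sim j l (r j) (r l) (s j) (s l).
Proof. by move=> Rr Rs /upd2E E; exists r; rewrite upd2_id E. Qed.

Lemma simC j l x y x' y' : j != l -> sim j l x y x' y' -> sim l j y x y' x'.
Proof. by move=> jl [r [H1 H2]]; exists r; rewrite -!(upd2C _ _ _ jl). Qed.

Lemma sim_thr j l x y y' : sim j l x y x y' -> th l y y'.
Proof. by case=> r [? ?]; exists (upd r j x). Qed.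

Lemma sim_thl j l x y x' : j != l -> sim j l x y x' y -> th j x x'.
Proof. by move=> jl /(simC jl)/sim_thr. Qed.

Lemma sim_Bl j l x y x' y' : j != l -> sim j l x y x' y' -> Bs j x.
Proof. by move=> jl [r [Rr _]]; have := Bs_of j Rr; rewrite upd2_1. Qed.

Lemma sim_Br j l x y x' y' : sim j l x y x' y' -> Bs l y.
Proof. by case=> r [Rr _]; have := Bs_of l Rr; rewrite upd2_2. Qed.

Lemma sim_refl_th j l x y x1 y1 : j != l ->
  sim j l x y x y -> th j x x1 -> th l y y1 -> sim j l x y x1 y1.
Proof.
move=> jl [r [Rr _]] tx ty; exists r; split=> //.
by apply: (th_upd (x := y)) => //; rewrite updC //; apply: (th_upd (x := x)) => //;
  rewrite -updC.
Qed.

(** Values may be replaced by [th]-equivalent ones, so [sim j l] can be studied on the fork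
    quotients. *)
Lemma sim_th j l x y x' y' x1 y1 x1' y1' : j != l ->
  th j x x1 -> th l y y1 -> th j x' x1' -> th l y' y1' ->
  sim j l x y x' y' -> sim j l x1 y1 x1' y1'.
Proof.
move=> jl tx ty tx' ty' S.
have S1 : sim j l x y x y by apply: sim_trans S (sim_sym S).
have S2 : sim j l x' y' x' y' by apply: sim_trans (sim_sym S) S.
apply: sim_trans (sim_sym (sim_refl_th jl S1 tx ty)) _.
exact: sim_trans S (sim_refl_th jl S2 tx' ty').
Qed.

Section Preserved.
Variables (n : nat) (g : op T n).
Hypothesis gR : prs g R.

Lemma pr2_th z : pr2 g (th z).
Proof.
move=> x y /choice[r Hr]; exists (fun k => g [ffun j => r j k]).
split; [have := gR (fun j => proj1 (Hr j)) | have := gR (fun j => proj2 (Hr j))];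
  congr R; apply/funext=> k; rewrite /upd; case: eqP => // _;
  by congr (g _); apply/ffunP=> j; rewrite !ffunE.
Qed.

Lemma pr1_Bs z : pr1 g (Bs z).
Proof. by move=> x Hx; apply: pr2_th. Qed.

Lemma pr4_sim j l : pr4 g (sim j l).
Proof.
move=> x y x' y' /choice[r Hr]; exists (fun k => g [ffun j => r j k]).
split; [have := gR (fun j => proj1 (Hr j)) | have := gR (fun j => proj2 (Hr j))];
  congr R; apply/funext=> k; rewrite /upd2 /upd; case: eqP => _;
  by [congr (g _); apply/ffunP=> i; rewrite !ffunE | case: eqP => // _].
Qed.

End Preserved.
End Fork.

Lemma exists_third (K : finType) (j l : K) : 2 < #|K| -> exists k, k != j /\ k != l.
Proof.
move=> K3; have [k] : exists k, k \in ~: [set j; l].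
  apply/card_gt0P; rewrite -(ltn_add2l #|[set j; l]|) addn0 cardsC.
  by apply: leq_ltn_trans K3; rewrite cards2; case: eqP.
by rewrite !inE negb_or => /andP[]; exists k.
Qed.

Lemma card_predC1_sig (K : finType) (z : K) : #|{: {k | k != z}}| < #|K|.
Proof.
by rewrite card_sig (cardD1 z [pred _ | true]) !inE ltnS;
  apply/subset_leq_card/subsetP=> k; rewrite !inE andbT.
Qed.

(** * The reduction step *)

Section Interpolation.
Variables (T : finType) (I : Type) (ar : I -> nat) (ops : forall i, op T (ar i)).
Variable D : T -> T -> T -> T.
Hypothesis D1 : forall x y, D y x x = y.
Hypothesis D2 : forall x y, D x x y = y.
Hypothesis clD : forall (K : finType) (P : (K -> T) -> Prop), clK ops P ->
  forall r1 r2 r3, P r1 -> P r2 -> P r3 -> P (fun k => D (r1 k) (r2 k) (r3 k)).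

Lemma cl2D P x x' x'' y y' y'' : cl2 ops P -> P x y -> P x' y' -> P x'' y'' ->
  P (D x x' x'') (D y y' y'').
Proof.
move=> clP P1 P2 P3.
have c : clK ops (fun r : bool -> T => P (r true) (r false)).
  by move=> i; apply/prs_bool.
exact: (clD c (r1 := fun b => if b then x else y) (r2 := fun b => if b then x' else y')
  (r3 := fun b => if b then x'' else y'')).
Qed.

(** [D] applied to [(x, x)], [(x, y)], [(y, y)] gives [(y, x)]. Together with [cl2_refl_trans] this
    makes every reflexive invariant relation a congruence. *)
Lemma cl2_refl_sym P : cl2 ops P -> (forall x, P x x) -> forall x y, P x y -> P y x.
Proof.
move=> clP Pr x y Pxy.
by have := cl2D clP (Pr x) Pxy (Pr y); rewrite D1 D2.
Qed.

Lemma cl2_refl_trans P : cl2 ops P -> (forall x, P x x) ->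
  forall x y z, P x y -> P y z -> P x z.
Proof.
move=> clP Pr x y z Pxy Pyz.
by have := cl2D clP Pxy (Pr y) Pyz; rewrite D1 D2.
Qed.

Variables (n : nat) (f : op T n) (K : finType) (R : (K -> T) -> Prop).
Hypothesis clR : clK ops R.
Hypothesis IH : forall K' : finType, #|K'| < #|K| ->
  forall P : (K' -> T) -> Prop, clK ops P -> prs f P.

Lemma RD r1 r2 r3 : R r1 -> R r2 -> R r3 -> R (fun k => D (r1 k) (r2 k) (r3 k)).
Proof. exact: clD. Qed.

Lemma IH1 P : 1 < #|K| -> cl1 ops P -> pr1 f P.
Proof.
by move=> K1 clP; apply/prs_unit; apply: IH => [|i]; [rewrite card_unit | apply/prs_unit].
Qed.

Lemma IH2 P : 2 < #|K| -> cl2 ops P -> pr2 f P.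
Proof.
by move=> K2 clP; apply/prs_bool; apply: IH => [|i]; [rewrite card_bool | apply/prs_bool].
Qed.

Variable rows : 'I_n -> K -> T.
Hypothesis Rrows : forall i, R (rows i).
Let t : K -> T := fun k => f [ffun i => rows i k].

(** Forgetting coordinate [z] leaves an invariant relation on fewer coordinates, to which the
    induction hypothesis applies. *)
Lemma agree_off z : exists b, R (upd t z b).
Proof.
pose P (y : {k | k != z} -> T) := exists2 r, R r & forall k, y k = r (val k).
have clP : clK ops P.
  move=> i ys /(_ _)/cid2 H; pose r j := s2val (H j).
  exists (fun k => ops i [ffun j => r j k]).
    by apply: clR => j; rewrite /r; case: (H j).
  move=> k; congr (ops i _); apply/ffunP=> j; rewrite !ffunE /r.
  by case: (H j).
have [|r Rr rE] := IH (card_predC1_sig z) clP (rows := fun i k => rows i (val k)).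
  by move=> i; exists (rows i).
exists (r z); rewrite updE // => k kz.
exact: (rE (exist _ k kz)).
Qed.

(* If [f] preserves [sim j l], then all rows may be changed at [j] and [l]
   inside [R]; once coordinate [j] is tied to coordinate [k] by [E], it
   can be eliminated and the induction hypothesis applies. *)
Lemma move_close j l k (E : T -> T -> Prop) : j != l -> k != j -> 1 < #|K| ->
  pr4 f (sim R j l) -> cl2 ops E -> pr2 f E ->
  (forall x x' y, E x y -> E x' y -> Bs R j x -> Bs R j x' -> th R j x x') ->
  (forall r, R r -> exists x y, R (upd2 r j l x y) /\ E x (upd2 r j l x y k)) ->
  R t.
Proof.
move=> jl kj K1 fsim clE fE Eth Emv.
have /choice[x Hx] : forall i, exists x, exists y,
    R (upd2 (rows i) j l x y) /\ E x (upd2 (rows i) j l x y k).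
  by move=> i; have [x [y ?]] := Emv _ (Rrows i); exists x, y.
have /choice[y Hy] := Hx => {Hx}.
pose rows' i := upd2 (rows i) j l (x i) (y i).
have Rrows' i : R (rows' i) by have [] := Hy i.
have Erows' i : E (rows' i j) (rows' i k).
  by rewrite /rows' upd2_1 //; have [] := Hy i.
pose t' k := f [ffun i => rows' i k].
(* Among the tuples of [R] tied by [E] at [j] and [k], coordinate [j] is dropped; the resulting [P]
   is invariant and has fewer coordinates, so [f] preserves it. *)
have Rt' : R t'.
  pose P (y : {k | k != j} -> T) :=
    exists2 r, R r & (forall k, y k = r (val k)) /\ E (r j) (r k).
  have clP : clK ops P.
    move=> i ys /(_ _)/cid2 H; pose r j := s2val (H j).
    have Hr a : (forall k, ys a k = r a (val k)) /\ E (r a j) (r a k).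
      by rewrite /r; case: (H a).
    exists (fun k => ops i [ffun j => r j k]).
      by apply: clR => a; rewrite /r; case: (H a).
    split; last by apply: clE => a; have [] := Hr a.
    move=> k'; congr (ops i _); apply/ffunP=> a; rewrite !ffunE.
    by have [] := Hr a.
  have [|r Rr [rE Erk]] := IH (card_predC1_sig j) clP (rows := fun i k => rows' i (val k)).
    by move=> i; exists (rows' i).
  have {}rE a : a != j -> t' a = r a by move=> aj; apply: (rE (exist _ a aj)).
  (* [r] agrees with [t'] off [j], and both values at [j] are tied to the same value at [k], hence
     equivalent under [th]. *)
  have <- : upd r j (t' j) = t' by apply: updE => a /rE.
  apply: (th_sub D1 D2 RD) => //.
  apply: Eth (Erk) _ (Bs_of _ Rr) _.
    by rewrite -rE //; apply: fE.
  have fB : pr1 f (Bs R j) by apply: IH1 => // i; apply: pr1_Bs.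
  by apply: fB => i; apply: Bs_of.
(* [t] and [t'] differ at most at [j] and [l]; their pairs of values there are related because [f]
   preserves [sim j l], which relates each row to its modification. *)
have tt' k' : k' != j -> k' != l -> t' k' = t k'.
  move=> k'j k'l; congr (f _); apply/ffunP=> i; rewrite !ffunE /rows'.
  by rewrite upd2_neq.
rewrite -(upd2E tt').
apply: (sim_sub D1 D2 RD) => //.
apply: fsim => i; apply: sim_of => // k' k'j k'l.
by rewrite /rows' upd2_neq.
Qed.

End Interpolation.

Section ForkPoint.
Variables (T : finType) (K : finType) (R : (K -> T) -> Prop).
Variable D : T -> T -> T -> T.
Hypothesis D1 : forall x y, D y x x = y.
Hypothesis D2 : forall x y, D x x y = y.
Hypothesis RD : forall r1 r2 r3, R r1 -> R r2 -> R r3 ->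
  R (fun k => D (r1 k) (r2 k) (r3 k)).
Variables t b : K -> T.
Hypothesis nRt : ~ R t.
Hypothesis Rb : forall z, R (upd t z (b z)).

Lemma not_th_tb z : ~ th R z (t z) (b z).
Proof.
move=> /th_sym/(th_upd D1 D2 RD (Rb z)); by rewrite upd_id.
Qed.

Lemma Bs_b z : Bs R z (b z). Proof. exact: Bs_upd (Rb z). Qed.

Lemma Bs_t z z' : z != z' -> Bs R z (t z).
Proof. by move=> zz'; have := Bs_of z (Rb z'); rewrite upd_neq. Qed.

Lemma t_neq_b z z' : z != z' -> t z <> b z.
Proof. by move=> zz' E; apply: (@not_th_tb z); rewrite -E; apply: Bs_t zz'. Qed.

(* The fork algebra [Bs z / th z] has exactly two elements, respectively is the
   whole algebra. *)
Definition two z := forall x, Bs R z x -> th R z x (t z) \/ th R z x (b z).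
Definition non z := (forall x, Bs R z x) /\ (forall x y, th R z x y -> x = y).

Lemma sim_btb j l : j != l -> sim R j l (b j) (t l) (t j) (b l).
Proof.
move=> jl; exists t; rewrite /upd2 upd_id; split; last exact: Rb.
by rewrite updC // upd_id.
Qed.

(* The witness is [D] applied to the three tuples forking at [k], [l] and [j]. *)
Lemma sim_ttbb j l k : j != l -> k != j -> k != l ->
  (forall y, R (upd2 (upd t k (b k)) j l (b j) y) -> th R l y (t l) \/ th R l y (b l)) ->
  sim R j l (t j) (t l) (b j) (b l).
Proof.
move=> jl kj kl Hy.
set r := upd t k (b k).
have Rr : R r by apply: Rb.
pose y := D (t l) (b l) (t l).
have Ry : R (upd2 r j l (b j) y).
  have := RD Rr (Rb l) (Rb j); congr R; apply/funext=> a.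
  rewrite /upd2 /r /upd.
  case: (a =P l) => [->|/eqP al];
    first by rewrite [l == k]eq_sym (negbTE kl) [l == j]eq_sym (negbTE jl).
  case: (a =P j) => [->|/eqP aj]; last by rewrite D1.
  by rewrite [j == k]eq_sym (negbTE kj) D2.
have E : upd2 r j l (t j) (t l) = r.
  have -> : t j = r j by rewrite /r upd_neq // eq_sym.
  have -> : t l = r l by rewrite /r upd_neq // eq_sym.
  exact: upd2_id.
exists r; split; first by rewrite E.
(* If [y] is equivalent to [t l], then [r] forks at [j] between [t j] and [b j], which [not_th_tb]
   excludes. *)
have [yt|yb] := Hy y Ry; last exact: th_upd D1 D2 RD _ _ _ _ Ry yb.
case: (@not_th_tb j); exists (upd r l (t l));
  rewrite -!(updC _ _ _ jl) -!/(upd2 _ _ _ _ _) E.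
by split=> //; apply: th_upd D1 D2 RD _ _ _ _ Ry yt.
Qed.

Section TwoTwo.
Variables j l k : K.
Hypotheses (jl : j != l) (kj : k != j) (kl : k != l).
Hypotheses (tj : two j) (tl : two l).

Let lj : l != j. Proof. by rewrite eq_sym. Qed.

Lemma two_sim_ttbb : sim R j l (t j) (t l) (b j) (b l).
Proof.
apply: (sim_ttbb jl kj kl) => y Ry; apply: tl.
by have := Bs_of l Ry; rewrite upd2_2.
Qed.

(** Up to [th] each coordinate takes the value of [t] or of [b]. [two_sim_ttbb] and [sim_btb] link
    the opposite corners of this square, and each corner is linked to itself; the other combinations
    contradict the hypothesis. *)
Lemma two_sim x y x' y' : Bs R j x -> Bs R l y -> Bs R j x' -> Bs R l y' ->
  (th R j x x' <-> th R l y y') -> sim R j l x y x' y'.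
Proof.
move=> Bx By Bx' By' xy.
have S1 := two_sim_ttbb; have S2 := sim_btb jl.
have rS u v u1 v1 : sim R j l u v u1 v1 -> sim R j l u v u v.
  by move=> S; apply: sim_trans D1 D2 RD _ _ _ _ _ _ _ _ S (sim_sym S).
have trj := th_trans D1 D2 RD (z := j); have trl := th_trans D1 D2 RD (z := l).
have nj := @not_th_tb j; have nl := @not_th_tb l.
have ntbj a c : th R j a (t j) -> th R j c (b j) -> ~ th R j a c.
  by move=> at' cb ac; apply: nj; apply: trj (th_sym at') (trj _ _ _ ac cb).
have ntbl a c : th R l a (t l) -> th R l c (b l) -> ~ th R l a c.
  by move=> at' cb ac; apply: nl; apply: trl (th_sym at') (trl _ _ _ ac cb).
have mk u v u' v' : th R j x u -> th R l y v -> th R j x' u' -> th R l y' v' ->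
    sim R j l u v u' v' -> sim R j l x y x' y'.
  by move=> *; apply: (sim_th D1 D2 RD jl) (th_sym _) (th_sym _) (th_sym _) (th_sym _) _;
    eassumption.
case: (tj Bx) (tj Bx') (tl By) (tl By') => [xt|xb] [xt'|xb'] [yt|yb] [yt'|yb'];
  try (by apply: mk; try eassumption;
    by [apply: rS S1 | apply: rS (sim_sym S1) | apply: rS S2 | apply: rS (sim_sym S2)
       | apply: S1 | apply: S2 | apply: sim_sym S1 | apply: sim_sym S2]).
all: exfalso.
all: first [ have := proj1 xy (trj _ _ _ xt (th_sym xt')) | have := proj1 xy (trj _ _ _
  xb (th_sym xb'))
  | have := proj2 xy (trl _ _ _ yt (th_sym yt')) | have := proj2 xy (trl _ _ _ yb (th_sym
    yb')) ].
all: first [ by apply: ntbj | by apply: ntbl | by move/th_sym;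
  apply: ntbj | by move/th_sym; apply: ntbl].
Qed.

(** Once the values at one coordinate are equivalent they can be made equal, and the two tuples then
    fork at the other coordinate. *)
Lemma sim_two x y x' y' : sim R j l x y x' y' -> (th R j x x' <-> th R l y y').
Proof.
move=> S.
have Bx := sim_Bl jl S; have By := sim_Br S.
have Bx' := sim_Bl jl (sim_sym S); have By' := sim_Br (sim_sym S).
split=> H.
  by apply: (@sim_thr _ _ _ j l x'); apply: (sim_th D1 D2 RD jl) S => //; apply: th_sym.
by apply: (@sim_thl _ _ _ j l x y') => //; apply: (sim_th D1 D2 RD jl) S => //;
  apply: th_sym.
Qed.

Lemma two_move r x : R r -> Bs R j x -> exists y, R (upd2 r j l x y).
Proof.
move=> Rr Bx.
have [|nth] := EM (th R j (r j) x).
  move=> H; exists (r l); apply: (sim_sub D1 D2 RD) => //.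
  apply: two_sim => //; try exact: Bs_of.
  by split=> // _; exact: (Bs_of l Rr).
have [y By ny] : exists2 y, Bs R l y & ~ th R l (r l) y.
  have [H|H] := tl (Bs_of l Rr).
    exists (b l); first exact: (Bs_b l).
    move=> H'; apply: (@not_th_tb l).
    exact: th_trans D1 D2 RD _ _ _ _ (th_sym H) H'.
  exists (t l); first exact: (Bs_t lj).
  move=> H'; apply: (@not_th_tb l).
  exact: th_trans D1 D2 RD _ _ _ _ (th_sym H') H.
exists y; apply: (sim_sub D1 D2 RD) => //.
by apply: two_sim => //; exact: Bs_of.
Qed.

End TwoTwo.
End ForkPoint.

(** * Arity at least three on a three-element set *)

Definition o0 : 'I_3 := @Ordinal 3 0 isT.
Definition o1 : 'I_3 := @Ordinal 3 1 isT.
Definition o2 : 'I_3 := @Ordinal 3 2 isT.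

Lemma I3_cases (x : 'I_3) : [\/ x = o0, x = o1 | x = o2].
Proof.
by case: x => -[|[|[|//]]] ?; [constructor 1 | constructor 2 | constructor 3];
  apply/val_inj.
Qed.

Lemma I3_ind (P : 'I_3 -> Prop) : P o0 -> P o1 -> P o2 -> forall x, P x.
Proof. by move=> P0 P1 P2 x; case: (I3_cases x) => ->. Qed.

(** Quantification over the three elements as a boolean, so that finite checks are settled by
    [vm_compute]. *)
Definition all3 (p : 'I_3 -> bool) := [&& p o0, p o1 & p o2].

Lemma all3P p : all3 p -> forall x, p x.
Proof. by case/and3P=> ? ? ?; apply: I3_ind. Qed.

Lemma I3_cover (e s u x : 'I_3) : e <> s -> e <> u -> s <> u -> [\/ x = e, x = s | x = u].
Proof.
move=> /eqP es /eqP eu /eqP su.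
have H : all3 (fun e => all3 (fun s => all3 (fun u => all3 (fun x =>
  [&& e != s, e != u & s != u] ==> [|| x == e, x == s | x == u])))) by vm_compute.
have := all3P (all3P (all3P (all3P H e) s) u) x.
by rewrite es eu su /= => /or3P[]/eqP; [constructor 1 | constructor 2 | constructor 3].
Qed.

Lemma I3_third (x y : 'I_3) : exists a, a != x /\ a != y.
Proof. by apply: exists_third; rewrite card_ord. Qed.

Definition mu (x y : 'I_3) := (x == o2) == (y == o2).

(* On a two-element set, [u = min(x, y, z)] iff [(x == z) = (y == u)]; so this is
   membership of [(x, y, x', y')] in [T'_i]. *)
Definition par (i x y x' y' : 'I_3) :=
  [&& x != i, y != i, x' != i, y' != i & (x == x') == (y == y')].

(** Membership in [Trel]: the equation x - y + z = u modulo 3 with the subtraction moved across. *)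
Definition Tb (x y z u : 'I_3) := (x + z) %% 3 == (y + u) %% 3.

Definition par2 (x y x' y' : 'I_3) :=
  par o2 x y x' y' || [&& x == o2, y == o2, x' == o2 & y' == o2].

(** Membership in [Tmu2]: with two classes only, minority is a parity condition, as for [par]. *)
Definition parmu (x y x' y' : 'I_3) := mu x x' == mu y y'.

(** Membership in [S01]: the third entry only tells, through its class, whether the first two
    agree. *)
Definition S01b (x y z : 'I_3) := [&& x != o2, y != o2 & (x == y) == (z != o2)].

Section ThreeElements.
Variables (I : Type) (ar : I -> nat) (ops : forall i, op 'I_3 (ar i)).
Variable D : 'I_3 -> 'I_3 -> 'I_3 -> 'I_3.
Hypothesis D1 : forall x y, D y x x = y.
Hypothesis D2 : forall x y, D x x y = y.
Hypothesis clD : forall (K : finType) (P : (K -> 'I_3) -> Prop), clK ops P ->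
  forall r1 r2 r3, P r1 -> P r2 -> P r3 -> P (fun k => D (r1 k) (r2 k) (r3 k)).
Variables (n : nat) (f : op 'I_3 n) (K : finType) (R : (K -> 'I_3) -> Prop).
Hypothesis clR : clK ops R.
Variables t b : K -> 'I_3.
Hypothesis nRt : ~ R t.
Hypothesis Rb : forall z, R (upd t z (b z)).

Let RDD := RD clD clR.

(** A value [e] equivalent neither to [t z] nor to [b z] makes these three values pairwise
    inequivalent, and they exhaust the universe. *)
Lemma two_or_non z z' : z != z' -> two R t b z \/ non R z.
Proof.
move=> zz'; have [|/existsNP[e /not_implyP[Be /not_orP[et eb]]]] := EM (two R t b z).
  by left.
right.
have cov x : [\/ x = e, x = t z | x = b z].
  apply: I3_cover; last exact: (t_neq_b D1 D2 RDD nRt Rb zz').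
    by move=> E; apply: et; rewrite -E.
  by move=> E; apply: eb; rewrite -E.
have ntb := not_th_tb D1 D2 RDD nRt Rb (z := z).
split=> [x|x y xy].
  by case: (cov x) => ->; [exact: Be | exact: (Bs_t Rb zz') | exact: (Bs_b Rb)].
have yx := th_sym xy.
by case: (cov x) (cov y) xy yx => -> [] -> // *; exfalso; auto.
Qed.

Let clth z : cl2 ops (th R z).
Proof. by move=> i; apply: pr2_th. Qed.
Let clBs z : cl1 ops (Bs R z).
Proof. by move=> i; apply: pr1_Bs. Qed.
Let clsim j l : cl4 ops (sim R j l).
Proof. by move=> i; apply: pr4_sim. Qed.

(* The two linkedness congruences of coordinate [j] relative to [l]: tuples
   that differ only at [j] and [l], respectively tuples that agree at [l]. *)
Definition beta j l y y' := exists x x', sim R j l y x y' x'.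
Definition gamma j l y y' :=
  exists r r', [/\ R r, R r', r l = r' l, r j = y & r' j = y'].

Lemma cl2_beta j l : cl2 ops (beta j l).
Proof.
move=> i y y' /choice[x /choice[x' H]].
by do 2!eexists; apply: (clsim (x := y) (y := x) (z := y') (u := x')).
Qed.

Lemma cl2_gamma j l : cl2 ops (gamma j l).
Proof.
move=> i y y' /choice[r /choice[r' H]].
exists (fun k => ops i [ffun a => r a k]), (fun k => ops i [ffun a => r' a k]).
split; try by apply: clR => a; case: (H a).
- by congr (ops i _); apply/ffunP=> a; rewrite !ffunE; case: (H a).
- by congr (ops i _); apply/ffunP=> a; rewrite !ffunE; case: (H a).
by congr (ops i _); apply/ffunP=> a; rewrite !ffunE; case: (H a).
Qed.

Lemma beta_tb j l : j != l -> beta j l (t j) (b j).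
Proof.
by move=> jl; exists (b l), (t l); apply/sim_sym; apply: sim_btb.
Qed.

Lemma gamma_tb j l k : j != l -> k != j -> k != l -> gamma j l (t j) (b j).
Proof.
move=> jl kj kl; exists (upd t k (b k)), (upd t j (b j)); split=> //.
- by rewrite !upd_neq // eq_sym.
- by rewrite upd_neq // eq_sym.
by rewrite upd_eq.
Qed.

Lemma beta_refl j l y : Bs R j y -> beta j l y y.
Proof.
by move=> /Bs_ex[r Rr <-]; exists (r l), (r l); apply: sim_of.
Qed.

Lemma gamma_refl j l y : Bs R j y -> gamma j l y y.
Proof. by move=> /Bs_ex[r Rr <-]; exists r, r. Qed.

(** [D] transports the pair of tuples witnessing [beta] to the tuple [r], at the price of an
    uncontrolled value at [l]. *)
Lemma beta_move j l r y : j != l -> R r -> beta j l (r j) y -> exists x, R (upd2 r j l y x).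
Proof.
move=> jl Rr [x [x' [s [S1 S2]]]].
exists (D (r l) x x'); have := RDD Rr S1 S2; congr R; apply/funext=> k.
rewrite /upd2 /upd; case: eqP => [->//|_]; case: eqP => [->|_]; first by rewrite D2.
by rewrite D1.
Qed.

Lemma gamma_full j l : (forall y y', gamma j l y y') ->
  forall r y, R r -> exists s, [/\ R s, s j = y & s l = r l].
Proof.
move=> full r y Rr.
have [p [q [Rp Rq E pj qj]]] := full (r j) y.
exists (fun k => D (r k) (p k) (q k)); split; first exact: RDD.
  by rewrite pj qj D2.
by rewrite E D1.
Qed.

Variable rows : 'I_n -> K -> 'I_3.
Hypothesis Rrows : forall i, R (rows i).
Hypothesis tE : t = fun k => f [ffun i => rows i k].
Hypothesis IH : forall K' : finType, #|K'| < #|K| ->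
  forall P : (K' -> 'I_3) -> Prop, clK ops P -> prs f P.
Hypothesis K3 : 2 < #|K|.

Let move_close' j l k E := @move_close _ _ _ ops D D1 D2 clD n f K R clR IH rows Rrows j
  l k E.

Lemma three_coords : exists j l k : K, [/\ j != l, k != j & k != l].
Proof.
have /card_gt0P[j _] : 0 < #|K| by apply: leq_trans K3.
have [l [lj _]] := exists_third j j K3; have [k [kj kl]] := exists_third j l K3.
by exists j, l, k; rewrite eq_sym.
Qed.

Let K1 : 1 < #|K|. Proof. exact: ltnW. Qed.

Lemma two_simP j l k ij il : j != l -> k != j -> k != l -> two R t b j -> two R t b l ->
  (forall x, Bs R j x <-> x != ij) -> (forall x y, th R j x y -> x = y) ->
  (forall x, Bs R l x <-> x != il) -> (forall x y, th R l x y -> x = y) ->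
  forall x y x' y', sim R j l x y x' y' <->
    [&& x != ij, y != il, x' != ij, y' != il & (x == x') == (y == y')].
Proof.
move=> jl kj kl tj tl Bj thj Bl thl x y x' y'; split=> [S|].
  have Bx := sim_Bl jl S; have By := sim_Br S.
  have Bx' := sim_Bl jl (sim_sym S); have By' := sim_Br (sim_sym S).
  have [H1 H2] := sim_two D1 D2 RDD jl S.
  apply/and5P; split; try exact/Bj; try exact/Bl.
  apply/eqP; apply/eqP/eqP => E.
    by apply: thl; apply: H1; rewrite E.
  by apply: thj; apply: H2; rewrite E.
case/and5P=> /Bj Bx /Bl By /Bj Bx' /Bl By' /eqP E.
apply: (two_sim D1 D2 RDD nRt Rb jl kj kl tj tl) => //.
split=> [/thj/eqP|/thl/eqP]; first by rewrite E => /eqP <-.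
by rewrite -E => /eqP <-.
Qed.

(** Here [sim j l] is exactly [par i], and [two_move] can give coordinate [j] the value at [k]; the
    tie is equality. *)
Lemma same_type j l k i : j != l -> k != j -> k != l ->
  two R t b j -> two R t b l ->
  (forall x, Bs R j x <-> x != i) -> (forall x y, th R j x y -> x = y) ->
  (forall x, Bs R l x <-> x != i) -> (forall x y, th R l x y -> x = y) ->
  (forall x, Bs R k x -> x != i) -> (cl4 ops (par i) -> pr4 f (par i)) -> R t.
Proof.
move=> jl kj kl tj tl Bj thj Bl thl Bk fp.
have sP x y x' y' : sim R j l x y x' y' <-> par i x y x' y'.
  exact: two_simP jl kj kl tj tl Bj thj Bl thl x y x' y'.
have clp : cl4 ops (par i).
  by move=> a x y x' y' H; apply/sP; apply: clsim => c; apply/sP.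
rewrite tE; apply: (@move_close' j l k eq) => //.
- by move=> x y x' y' H; apply/sP; apply: (fp clp) => c; apply/sP.
- by move=> a; apply: pr2_eq.
- exact: pr2_eq.
- by move=> x x' y -> ->.
- move=> r Rr; have [y Ry] : exists y, R (upd2 r j l (r k) y).
    apply: (two_move D1 D2 RDD nRt Rb jl kj kl) => //.
    by apply/Bj/Bk/Bs_of.
  by exists (r k), y; rewrite upd2_neq.
Qed.

(** * Simple algebras, arity at least three *)

Section Simple.
Hypothesis simp : forall E : 'I_3 -> 'I_3 -> Prop, cl2 ops E -> (forall x, E x x) ->
  forall x y, x <> y -> E x y -> forall x' y', E x' y'.

(** If the third element [i] occurred at [j], then [th R j] would be a nontrivial congruence of the
    whole algebra, hence full by simplicity, although it separates [t j] from [b j]. *)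
Lemma simple_two_type j l : j != l -> two R t b j ->
  exists i, (forall x, Bs R j x <-> x != i) /\ (forall x y, th R j x y -> x = y).
Proof.
move=> jl tj.
have tb : t j <> b j := t_neq_b D1 D2 RDD nRt Rb jl.
have [i [/eqP it /eqP ib]] := I3_third (t j) (b j).
have cov x := I3_cover x it ib tb.
have Bt := Bs_t Rb jl; have Bb := Bs_b Rb j.
have ntb := not_th_tb D1 D2 RDD nRt Rb (z := j).
have nBi : ~ Bs R j i.
  move=> Bi; apply: ntb.
  have rf x : th R j x x by case: (cov x) => ->.
  by case: (tj _ Bi) => H; apply: (simp (@clth j) rf _ H).
exists i; split=> [x|x y xy].
  split=> [Bx|]; first by apply/eqP=> E; apply: nBi; rewrite -E.
  by case: (cov x) => ->; rewrite ?eqxx.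
have := th_Bl xy; have := th_Br xy; have := th_sym xy; move: xy.
by case: (cov x) (cov y) => -> [] ->.
Qed.

Hypothesis f_par : forall i, cl4 ops (par i) -> pr4 f (par i).

(** If three coordinates omit the same element, [same_type] applies. Otherwise two coordinates omit
    different elements, and their only common value [a] forms a subuniverse. Fixing [a] in [sim j l]
    gives an isomorphism [g] of two-element algebras, through which [sim j l] becomes some [T'_i];
    coordinate [j] is then tied to the constant [a]. *)
Lemma simple_two : (forall z, two R t b z) -> R t.
Proof.
move=> tw.
have [j0 [l0 [k0 [jl0 kj0 kl0]]]] := three_coords.
have /choice[i Hi] : forall z, exists i,
    (forall x, Bs R z x <-> x != i) /\ (forall x y, th R z x y -> x = y).
  move=> z; have [k [kz _]] := exists_third z z K3.
  by apply: (simple_two_type _ (tw z) (l := k)); rewrite eq_sym.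
have simP j l k jl kj kl := two_simP (j := j) (l := l) (k := k) jl kj kl (tw j) (tw l)
  (proj1 (Hi j)) (proj2 (Hi j)) (proj1 (Hi l)) (proj2 (Hi l)).
have [[/eqP Ejl /eqP Ejk]|mixed] := EM (i j0 == i l0 /\ i j0 == i k0).
  apply: (@same_type j0 l0 k0 (i j0)) => //; try exact: (proj1 (Hi _));
    try exact: (proj2 (Hi _)).
  - by rewrite Ejl; apply: (proj1 (Hi _)).
  - by move=> x; rewrite Ejk => /(proj1 (Hi _)).
  - exact: f_par.
have [j [l [k [jl [kj kl] ij]]]] : exists j l k, [/\ j != l, k != j /\ k != l & i j <> i l].
  case: (i j0 =P i l0) mixed => E1; last by exists j0, l0, k0.
  case: (i j0 =P i k0) => E2; first by case.
  by exists j0, k0, l0; rewrite eq_sym kj0 eq_sym jl0 eq_sym kl0.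
have sP := simP _ _ _ jl kj kl.
have [a [aj al]] := I3_third (i j) (i l).
have cla : cl1 ops (fun x => x = a).
  move=> c x xa.
  have H1 : ops c [ffun k => x k] != i j.
    by apply/(proj1 (Hi j)); apply: clBs => d; apply/(proj1 (Hi j)); rewrite xa.
  have H2 : ops c [ffun k => x k] != i l.
    by apply/(proj1 (Hi l)); apply: clBs => d; apply/(proj1 (Hi l)); rewrite xa.
  case: (I3_cover (ops c [ffun k => x k]) (elimN eqP aj) (elimN eqP al) ij) => // E.
    by rewrite E eqxx in H1.
  by rewrite E eqxx in H2.
have fa := IH1 IH K1 cla.
pose g x y := sim R j l x y a a.
have clg : cl2 ops g.
  move=> c x y H; have := @clsim j l c x y (fun=> a) (fun=> a) H.
  by rewrite (cla c (fun=> a)).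
have fg := IH2 IH K3 clg.
have gP x y : g x y <-> [&& x != i j, y != i l & (x == a) == (y == a)].
  by split=> [/sP|/and3P[? ? ?]]; [case/and5P=> -> -> _ _ -> | apply/sP/and5P].
(* [u y] is the element of [B j] matched with [y] by [g]. *)
pose u y := if y == a then a else i l.
have gu y : y != i l -> g (u y) y.
  move=> yl; apply/gP; rewrite yl /u; case: (y =P a) => _; rewrite ?aj ?eqxx //=.
  by rewrite [i l == _]eq_sym (introN eqP ij) [i l == _]eq_sym (negbTE al).
have H2187 : all3 (fun ij => all3 (fun il => all3 (fun a => all3 (fun u => all3 (fun u' =>
    all3 (fun y => all3 (fun y' =>
    [&& ij != il, a != ij, a != il, u != ij, u' != ij & [&& y != il, y' != il,
       (u == a) == (y == a) & (u' == a) == (y' == a)]] ==>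
    ((u == u') == (y == y'))))))))) by vm_compute.
have guE v v' y y' : g v y -> g v' y' -> (v == v') = (y == y').
  move=> /gP/and3P[v1 y1 E1] /gP/and3P[v2 y2 E2].
  have := all3P (all3P (all3P (all3P (all3P (all3P (all3P H2187 (i j)) (i l)) a) v) v')
    y) y'.
  by rewrite (introN eqP ij) aj al v1 v2 y1 y2 E1 E2 => /eqP.
(* The second and fourth entries are carried through [g] to coordinate [l], where [sim j l] is
   invariant, and the results are carried back. *)
have clp : cl4 ops (par (i j)).
  have gx x : x != i j -> exists y, g x y.
    move=> xj; case: (x =P a) => [->|/eqP xa].
      by exists a; apply/gP; rewrite aj al eqxx.
    by exists (i j); apply/gP; rewrite xj (negbTE xa) [i j == a]eq_sym (negbTE aj)
      (introN eqP ij).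
  move=> c x y x' y' H.
  have /choice[w Hw] : forall d, exists w, g (y d) w.
    by move=> d; apply: gx; case/and5P: (H d).
  have /choice[w' Hw'] : forall d, exists w, g (y' d) w.
    by move=> d; apply: gx; case/and5P: (H d).
  have S : forall d, sim R j l (x d) (w d) (x' d) (w' d).
    move=> d; case/and5P: (H d) => ? ? ? ? /eqP E; apply/sP.
    have /gP/and3P[_ wl _] := Hw d; have /gP/and3P[_ wl' _] := Hw' d.
    by apply/and5P; split=> //; rewrite E (guE _ _ _ _ (Hw d) (Hw' d)).
  have /sP/and5P[x1 x2 x3 x4 /eqP x5] := clsim S (i := c).
  have g1 := clg c _ _ Hw; have g2 := clg c _ _ Hw'.
  apply/and5P; split=> //; first by case/gP/and3P: g1.
    by case/gP/and3P: g2.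
  by rewrite (guE _ _ _ _ g1 g2) x5.
have fsim : pr4 f (sim R j l).
  move=> x y x' y' H.
  have g1 : g (f [ffun d => u (y d)]) (f [ffun d => y d]).
    by apply: fg => d; apply: gu; have /sP/and5P[] := H d.
  have g2 : g (f [ffun d => u (y' d)]) (f [ffun d => y' d]).
    by apply: fg => d; apply: gu; have /sP/and5P[] := H d.
  have /and5P[p1 p2 p3 p4 /eqP p5] : par (i j) (f [ffun d => x d]) (f [ffun d => u (y d)])
      (f [ffun d => x' d]) (f [ffun d => u (y' d)]).
    apply: (f_par clp) => d; have /sP/and5P[q1 q2 q3 q4 /eqP q5] := H d.
    have g1' := gu _ q2; have g2' := gu _ q4.
    apply/and5P; split=> //; first by case/gP/and3P: g1'.
      by case/gP/and3P: g2'.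
    by rewrite q5 (guE _ _ _ _ g1' g2').
  apply/sP/and5P; split=> //; first by case/gP/and3P: g1.
    by case/gP/and3P: g2.
  by rewrite p5 (guE _ _ _ _ g1 g2).
rewrite tE; apply: (@move_close' j l k (fun x _ => x = a)) => //.
- by move=> c x y H; apply: cla.
- by move=> x y H; apply: fa.
- by move=> x x' y -> ->.
- move=> r Rr; have [y Ry] : exists y, R (upd2 r j l a y).
    by apply: (two_move D1 D2 RDD nRt Rb jl kj kl) => //; apply/(proj1 (Hi _)).
  by exists a, y.
Qed.

(** [beta] is reflexive and invariant and contains the distinct pair [t j], [b j], so simplicity
    makes it full; the same holds for [gamma]. *)
Lemma simple_beta j l : j != l -> non R j -> forall y y', beta j l y y'.
Proof.
move=> jl [Bj _]; apply: (simp (@cl2_beta j l)) (beta_tb jl).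
  by move=> y; apply: beta_refl.
exact: (t_neq_b D1 D2 RDD nRt Rb jl).
Qed.

Lemma simple_gamma j l : j != l -> non R j -> forall y y', gamma j l y y'.
Proof.
move=> jl [Bj _]; have [k [kj kl]] := exists_third j l K3.
apply: (simp (@cl2_gamma j l)) (gamma_tb jl kj kl).
  by move=> y; apply: gamma_refl.
exact: (t_neq_b D1 D2 RDD nRt Rb jl).
Qed.

(** Otherwise each of the three values at [j] extends the same remaining tuple with [t l] or [b l].
    Two of them then share their value at [l], which is a fork at [j] between distinct values. *)
Lemma simple_non_all j l : j != l -> non R j -> non R l.
Proof.
move=> jl nj; have lj : l != j by rewrite eq_sym.
have [tl|nl] := two_or_non lj; last exact: nl.
have /choice[p Hp] : forall y, exists p, (p = t l \/ p = b l) /\ R (upd2 (upd t j (b j))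
  j l y p).
  move=> y; have [x Rx] := beta_move jl (Rb j) (simple_beta jl nj _ y).
  have Bx : Bs R l x by have := Bs_of l Rx; rewrite upd2_2.
  by have [H|H] := tl x Bx; [exists (t l) | exists (b l)]; (split; first by [left | right]);
    apply: th_upd D1 D2 RDD _ _ _ _ Rx H.
have p_inj y y' : p y = p y' -> y = y'.
  move=> E; apply: (proj2 nj); apply: (@sim_thl _ _ _ j l y (p y)) => //.
  by exists (upd t j (b j)); split; [| rewrite E]; have [] := Hp y; have [] := Hp y'.
have [[[p0 _] [p1 _]] [p2 _]] := (Hp o0, Hp o1, Hp o2).
have := (@p_inj o0 o1, @p_inj o0 o2, @p_inj o1 o2).
by case: p0 p1 p2 => -> [] -> [] -> [[h1 h2] h3];
  first [discriminate (h1 erefl) | discriminate (h2 erefl) | discriminate (h3 erefl)].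
Qed.

(** * The affine structure over Z_3 *)

Section Affine.
Variables j l : K.
Hypotheses (jl : j != l) (nj : non R j) (nl : non R l).
Let S := sim R j l.
Let lj : l != j. Proof. by rewrite eq_sym. Qed.

Lemma aff_l x y y' : S x y x y' -> y = y'.
Proof. by move/sim_thr; apply: (proj2 nl). Qed.

Lemma aff_r x y x' : S x y x' y -> x = x'.
Proof. by move/(sim_thl jl); apply: (proj2 nj). Qed.

Lemma aff_full x y : exists r, [/\ R r, r j = x & r l = y].
Proof.
have [r Rr <-] := Bs_ex (proj1 nl y).
exact: gamma_full (simple_gamma jl nj) r x Rr.
Qed.

Lemma aff_refl x y : S x y x y.
Proof. by have [r [Rr <- <-]] := aff_full x y; apply: sim_of. Qed.

Lemma aff_exr x y x' : exists y', S x y x' y'.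
Proof.
have [r [Rr <- <-]] := aff_full x y.
have [y' Ry] := beta_move jl Rr (simple_beta jl nj _ x').
by exists y', r; rewrite upd2_id.
Qed.

Lemma aff_exl x y y' : exists x', S x y x' y'.
Proof.
have [r [Rr <- <-]] := aff_full x y.
have [x' Rx] := beta_move lj Rr (simple_beta lj nl _ y').
by exists x', r; rewrite upd2_id (upd2C _ _ _ jl).
Qed.

(** [D] on the tuples carrying [(x0, u)], [(x1, v)], [(x1, w)] has [x0] at [j] and [D u v w] at [l],
    and it agrees elsewhere with the tuple carrying [(x0, e)]; forks at [l] are trivial. *)
Lemma aff_D x0 x1 u v w e : S x0 u x1 v -> S x1 w x0 e -> e = D u v w.
Proof.
move=> [r [R1 R2]] [s [S1 S2]]; apply/esym/(proj2 nl).
exists (upd s j x0); split=> //.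
have := RDD R1 R2 S1; congr R; apply/funext=> k; rewrite /upd2 /upd.
by case: eqP => // _; case: eqP => _; rewrite ?D1 ?D2.
Qed.

Let St := @sim_trans _ _ R D D1 D2 RDD j l.

Lemma aff_Dex u v w : exists x0 x1, S x0 u x1 v /\ S x1 w x0 (D u v w).
Proof.
have [x1 H1] := aff_exl o0 u v; have [e H2] := aff_exr x1 w o0.
by exists o0, x1; rewrite -(aff_D H1 H2).
Qed.

Lemma aff_D_neq u v w : v <> w -> D u v w <> u.
Proof.
move=> vw E; apply: vw; have [x0 [x1 [H1]]] := aff_Dex u v w; rewrite E => H2.
exact: aff_l (St (sim_sym H1) (sim_sym H2)).
Qed.

Lemma aff_D_inj u u' v w : D u v w = D u' v w -> u = u'.
Proof.
have [x0 H0] := aff_exl o0 v u; have [x0' H0'] := aff_exl o0 v u'.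
have [e H] := aff_exr o0 w x0; have [e' H'] := aff_exr o0 w x0'.
rewrite -(aff_D (sim_sym H0) H) -(aff_D (sim_sym H0') H') => E.
have E0 : x0 = x0' by apply: (@aff_r _ e); apply: St (sim_sym H) _; rewrite E.
by apply: (@aff_l x0); apply: St (sim_sym H0) _; rewrite E0.
Qed.

(* For [v != w] the map [D _ v w] is a fixed-point-free permutation sending [v] to
   [w], hence a translation of Z_3. *)
Lemma aff_DE u v w : Tb u v w (D u v w).
Proof.
have H729 : all3 (fun v => all3 (fun w => all3 (fun p0 => all3 (fun p1 => all3 (fun p2 =>
    all3 (fun u => let p x := if x == o0 then p0 else if x == o1 then p1 else p2 in
    [&& v != w, p v == w, p0 != o0, p1 != o1, p2 != o2 & uniq [:: p0; p1; p2]] ==>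
    Tb u v w (p u))))))) by vm_compute.
have [->|vw] := eqVneq v w; first by rewrite D1 /Tb addnC.
pose p x := D x v w.
have := all3P (all3P (all3P (all3P (all3P (all3P H729 v) w) (p o0)) (p o1)) (p o2)) u.
have pE x : (if x == o0 then p o0 else if x == o1 then p o1 else p o2) = p x.
  by move: x; apply: I3_ind.
have pN x : p x != x by apply/eqP/aff_D_neq/eqP.
cbv beta zeta; rewrite !pE vw !pN /= {1}/p D2 eqxx /= !inE !negb_or /=.
have pI x y : x != y -> p x != p y by apply: contraNneq => /aff_D_inj->.
by rewrite !pI.
Qed.

Lemma Tb_inj u v w e e' : Tb u v w e -> Tb u v w e' -> e = e'.
Proof.
have H : all3 (fun u => all3 (fun v => all3 (fun w => all3 (fun e => all3 (fun e' =>
  [&& Tb u v w e & Tb u v w e'] ==> (e == e')))))) by vm_compute.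
move=> T1 T2; have := all3P (all3P (all3P (all3P (all3P H u) v) w) e) e'.
by rewrite T1 T2 => /eqP.
Qed.

Lemma TbE u v w e : Tb u v w e <-> e = D u v w.
Proof.
split=> [H|->]; last exact: aff_DE.
exact: Tb_inj H (aff_DE _ _ _).
Qed.

(** By [aff_Dex] and [aff_D] the graph of [D] is defined by two instances of [sim j l] with [x0] and
    [x1] quantified existentially, hence it is invariant; by [TbE] it is [Tb]. *)
Lemma cl4_Tb : cl4 ops Tb.
Proof.
move=> i u v w e H.
have /choice[x0 /choice[x1 Hx]] : forall a, exists x0 x1,
    S x0 (u a) x1 (v a) /\ S x1 (w a) x0 (e a).
  by move=> a; have /TbE-> := H a; apply: aff_Dex.
apply/TbE; apply: aff_D.
  by apply: (@clsim j l i x0 u x1 v) => a; have [] := Hx a.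
by apply: (@clsim j l i x1 w x0 e) => a; have [] := Hx a.
Qed.

Let SD x1 x2 x3 y1 y2 y3 z1 z2 z3 u1 u2 u3 :
  S x1 y1 z1 u1 -> S x2 y2 z2 u2 -> S x3 y3 z3 u3 ->
  S (D x1 x2 x3) (D y1 y2 y3) (D z1 z2 z3) (D u1 u2 u3).
Proof.
move=> [r [Hr Hr']] [s [Hs Hs']] [q [Hq Hq']].
exists (fun k => D (r k) (s k) (q k)); split.
  by have := RDD Hr Hs Hq; congr R; apply/funext=> k; rewrite /upd2 /upd;
    case: eqP => // _; case: eqP.
by have := RDD Hr' Hs' Hq'; congr R; apply/funext=> k; rewrite /upd2 /upd;
  case: eqP => // _; case: eqP.
Qed.

(* [sim] is the graph of [x - x' = e * (y - y')] for a fixed sign [e]. *)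
Lemma aff_sim : (forall x y x' y', S x y x' y' <-> Tb x x' y' y) \/
  (forall x y x' y', S x y x' y' <-> Tb x x' y y').
Proof.
(* The value [y1] reached from 0 at [l] while [j] goes from 0 to 1 decides the sign; [Sp] translates
   this step to an arbitrary pair by means of [D]. *)
have [y1 S1] := aff_exr o0 o0 o1.
have Sp p q : S p q (D o1 o0 p) (D y1 o0 q).
  by have := SD S1 (aff_refl o0 o0) (aff_refl p q); rewrite !D2.
have y10 : y1 != o0 by apply/eqP=> E; have := S1; rewrite E => /aff_r.
(* Since the last entry of [sim j l] is determined by the other three, one inclusion suffices. *)
have conv (P : 'I_3 -> 'I_3 -> 'I_3 -> 'I_3 -> bool) :
    (forall x y x' y', P x y x' y' -> S x y x' y') ->
    (forall x y x', exists y', P x y x' y') ->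
    forall x y x' y', S x y x' y' <-> P x y x' y'.
  move=> PS Pex x y x' y'; split; last exact: PS.
  move=> H; have [y'' Hy] := Pex x y x'.
  by rewrite (aff_l (St (sim_sym H) (PS _ _ _ _ Hy))).
pose s3 (x : 'I_3) := if x == o0 then o1 else if x == o1 then o2 else o0.
have s3E p : D o1 o0 p = s3 p.
  by apply/esym/TbE; move: p; apply: I3_ind.
have [E|E] : y1 = o1 \/ y1 = o2.
  by move: y1 y10 {S1 Sp}; apply: I3_ind; auto.
- have {}Sp p q : S p q (s3 p) (s3 q) by have := Sp p q; rewrite E !s3E.
  have Sp2 p q := St (Sp p q) (Sp (s3 p) (s3 q)).
  left; apply: conv => x y x'.
    have H : all3 (fun x => all3 (fun y => all3 (fun x' => all3 (fun y' => Tb x x' y' y ==>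
        [|| (x' == x) && (y' == y), (x' == s3 x) && (y' == s3 y) |
            (x' == s3 (s3 x)) && (y' == s3 (s3 y))])))) by vm_compute.
    move=> y' xy; have := all3P (all3P (all3P (all3P H x) y) x') y'.
    by rewrite xy => /or3P[]/andP[/eqP-> /eqP->];
      [exact: aff_refl | exact: Sp | exact: Sp2].
  exists (D x' x y); have := aff_DE x' x y.
  by rewrite /Tb eq_sym addnC [x' + y]addnC [y + x']addnC.
- have s3E2 p : D o2 o0 p = s3 (s3 p).
    by apply/esym/TbE; move: p; apply: I3_ind.
  have {}Sp p q : S p q (s3 p) (s3 (s3 q)) by have := Sp p q; rewrite E s3E s3E2.
  have Sp2 p q := St (Sp p q) (Sp (s3 p) (s3 (s3 q))).
  right; apply: conv => x y x'; last by exists (D x x' y); apply: aff_DE.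
  have H : all3 (fun x => all3 (fun y => all3 (fun x' => all3 (fun y' => Tb x x' y y' ==>
      [|| (x' == x) && (y' == y), (x' == s3 x) && (y' == s3 (s3 y)) |
          (x' == s3 (s3 x)) && (y' == s3 (s3 (s3 (s3 y))))])))) by vm_compute.
  move=> y' xy; have := all3P (all3P (all3P (all3P H x) y) x') y'.
  by rewrite xy => /or3P[]/andP[/eqP-> /eqP->]; [exact: aff_refl | exact: Sp | exact: Sp2].
Qed.

End Affine.

Hypothesis f_Tb : cl4 ops Tb -> pr4 f Tb.

Lemma simple_non : (exists j, non R j) -> R t.
Proof.
case=> j nj; have [l [lj _]] := exists_third j j K3;
  have [k [kj kl]] := exists_third j l K3.
have jl : j != l by rewrite eq_sym.
have nl := simple_non_all jl nj.
have fT := f_Tb (cl4_Tb jl nj nl).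
rewrite tE; apply: (@move_close' j l k eq) => //.
- have [sP|sP] := aff_sim jl nj nl => x y x' y' H; apply/sP.
    by apply: (fT x x' y' y) => a; apply/sP.
  by apply: (fT x x' y y') => a; apply/sP.
- by move=> a; apply: pr2_eq.
- exact: pr2_eq.
- by move=> x x' y -> ->.
- move=> r Rr; have [y Ry] := beta_move jl Rr (simple_beta jl nj _ (r k)).
  by exists (r k), y; rewrite upd2_neq.
Qed.

Lemma simple_step : R t.
Proof.
have [|nn] := EM (exists j, non R j); first exact: simple_non.
apply: simple_two => z; have [k [kz _]] := exists_third z z K3.
have zk : z != k by rewrite eq_sym.
by have [//|nz] := two_or_non zk; case: nn; exists z.
Qed.

End Simple.

(** * Algebras with monolith mu_2, arity at least three *)

Section Monolith.
Hypothesis clmu : cl2 ops mu.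

(** [D y x o2] is [mu]-related to [D x x o2 = o2], and the class of [o2] is a singleton, so
    [D y x o2 = o2]. Hence [E] relates [y = D y x x] to [o2] whenever [y] lies in the class of
    [x]. *)
Lemma mu_full (E : 'I_3 -> 'I_3 -> Prop) x : cl2 ops E -> (forall x, E x x) ->
  x <> o2 -> E x o2 -> forall y z, E y z.
Proof.
move=> clE rE /eqP x2 Ex.
have sy := cl2_refl_sym D1 D2 clD clE rE; have tr := cl2_refl_trans D1 D2 clD clE rE.
have E2 y : E y o2.
  have [->|y2] := eqVneq y o2; first exact: rE.
  have := cl2D clD clE (rE y) (rE x) Ex; rewrite D1.
  have : mu (D y x o2) (D x x o2).
    by apply: (cl2D clD clmu); rewrite /mu ?eqxx // (negbTE x2) (negbTE y2).
  by rewrite D2 /mu eqxx eqb_id => /eqP->.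
by move=> y z; apply: tr (E2 y) (sy _ _ (E2 z)).
Qed.

Lemma mu_least (E : 'I_3 -> 'I_3 -> Prop) x y : cl2 ops E -> (forall x, E x x) ->
  x <> y -> E x y -> E o0 o1.
Proof.
move=> clE rE xy Exy; have sy := cl2_refl_sym D1 D2 clD clE rE.
have [x2|/eqP x2] := eqVneq x o2.
  by apply: (mu_full clE rE (x := y)); [rewrite -x2; apply/nesym | rewrite -x2; apply: sy].
have [y2|/eqP y2] := eqVneq y o2.
  by apply: (mu_full clE rE x2); rewrite -y2.
case: (I3_cases x) (I3_cases y) xy Exy x2 y2 => -> [] -> // _ E10 _ _.
exact: sy.
Qed.

(* The fork algebra at [j] is the quotient of [A] by its monolith, possibly
   restricted to a transversal. *)
Definition star j := [/\ forall x y, Bs R j x -> Bs R j y -> (th R j x y <-> mu x y),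
  Bs R j o2 & exists2 e, e != o2 & Bs R j e].

(** If every value occurs at [j], then [th R j] is a proper nontrivial congruence, hence [mu] by
    [mu_least] and [mu_full]. Otherwise only [t j] and [b j] occur, and the two cases depend on
    whether one of them is [o2]. *)
Lemma mu_two_type j l : j != l -> two R t b j ->
  ((forall x, Bs R j x <-> x != o2) /\ (forall x y, th R j x y -> x = y)) \/ star j.
Proof.
move=> jl tj.
have tb : t j <> b j := t_neq_b D1 D2 RDD nRt Rb jl.
have Bt := Bs_t Rb jl; have Bb := Bs_b Rb j.
have ntb := not_th_tb D1 D2 RDD nRt Rb (z := j).
have [e [/eqP et /eqP eb]] := I3_third (t j) (b j).
have cov x := I3_cover x et eb tb.
have [Be|nBe] := EM (Bs R j e).
  right; have rf x : th R j x x by case: (cov x) => ->.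
  have th01 : th R j o0 o1.
    by case: (tj _ Be) => H; apply: (mu_least (@clth j) rf _ H).
  have n2 x : x <> o2 -> ~ th R j x o2.
    by move=> x2 H; apply: ntb; apply: (mu_full (@clth j) rf x2 H).
  split=> [x y _ _||]; [|exact: rf|by exists o0; [|apply: rf]].
  have := n2 x; have := n2 y; have := th_sym th01.
  case: (I3_cases x) (I3_cases y) => -> [] -> h10 h1 h2; split=> // H; exfalso;
    by [apply: h1 H | apply: h2 H | apply: h1 (th_sym H) | apply: h2 (th_sym H)].
have {}cov x : Bs R j x -> x = t j \/ x = b j.
  by move=> Bx; case: (cov x) => E; [case: nBe; rewrite -E | left | right].
have thE x y : th R j x y -> x = y.
  move=> xy; have yx := th_sym xy; have := cov _ (th_Bl xy); have := cov _ (th_Br xy).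
  by move=> cy cx; case: cx cy xy yx => -> [] ->.
have thmu x y : Bs R j x -> Bs R j y -> (mu (t j) (b j) -> t j = b j) -> (th R j x y <->
  mu x y).
  move=> Bx By H; split=> [/thE->|]; first by rewrite /mu.
  have ms : mu (b j) (t j) = mu (t j) (b j) by rewrite /mu eq_sym.
  by case: (cov _ Bx) (cov _ By) => -> [] -> //; rewrite ?ms => /H/tb.
have [t2|t2] := eqVneq (t j) o2.
  right; split=> [x y Bx By||].
  - by apply: thmu => //; rewrite t2 /mu eqxx => /eqP/esym/eqP->.
  - by rewrite -t2.
  - by exists (b j) => //; apply/eqP=> E; apply: tb; rewrite t2 E.
have [b2|b2] := eqVneq (b j) o2.
  right; split=> [x y Bx By||].
  - by apply: thmu => //; rewrite b2 /mu eqxx (negbTE t2).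
  - by rewrite -b2.
  - by exists (t j).
left; split=> // x; split=> [/cov[]->//|x2].
have := @I3_cover o2 (t j) (b j) x; case=> // [||E|->|->] //.
- by apply/eqP; rewrite eq_sym.
- by apply/eqP; rewrite eq_sym.
- by rewrite E eqxx in x2.
Qed.

Hypothesis fmu : pr2 f mu.
Hypothesis f_par : cl4 ops (par o2) -> pr4 f (par o2).
Hypothesis f_parmu : cl4 ops parmu -> pr4 f parmu.
Hypothesis f_S01 : cl3 ops S01b -> pr3 f S01b.
Hypothesis f_par2 : cl4 ops par2 -> pr4 f par2.

Let fBs z : pr1 f (Bs R z).
Proof. exact: (IH1 IH K1 (@clBs z)). Qed.

Let mu_eq x y z : mu x y -> mu x z = mu y z.
Proof. by rewrite /mu => /eqP->. Qed.
Let mu_eqr x y z : mu x y -> mu z x = mu z y.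
Proof. by rewrite /mu => /eqP->. Qed.

Lemma star_rep j : star j -> forall x, exists y, Bs R j y /\ mu x y.
Proof.
case=> _ B2 [e e2 Be] x; have [->|x2] := eqVneq x o2; first by exists o2.
by exists e; rewrite /mu (negbTE e2) (negbTE x2).
Qed.

Lemma star_simP j l k : j != l -> k != j -> k != l -> two R t b j -> two R t b l ->
  star j -> star l -> forall x y x' y', sim R j l x y x' y' <->
  [/\ Bs R j x, Bs R l y, Bs R j x', Bs R l y' & parmu x y x' y'].
Proof.
move=> jl kj kl tj tl [thj _ _] [thl _ _] x y x' y'; split=> [S|[Bx By Bx' By' /eqP E]].
  have Bx := sim_Bl jl S; have By := sim_Br S.
  have Bx' := sim_Bl jl (sim_sym S); have By' := sim_Br (sim_sym S).
  split=> //; apply/eqP; have [H1 H2] := sim_two D1 D2 RDD jl S.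
  by apply/idP/idP => [/(thj _ _ Bx Bx')/H1/(thl _ _ By By')|/(thl _ _ By By')/H2/(thj _
    _ Bx Bx')].
apply: (two_sim D1 D2 RDD nRt Rb jl kj kl tj tl) => //.
by split=> [/(thj _ _ Bx Bx')|/(thl _ _ By By')] H; [apply/thl; rewrite // -E | apply/thj;
  rewrite // E].
Qed.

(** [sim j l] is [parmu] restricted to the projections. Replacing arguments by [mu]-related
    representatives inside the projections makes all of [parmu] invariant; coordinate [j] is tied to
    [k] by [mu]. *)
Lemma all_star j l k : j != l -> k != j -> k != l -> two R t b j -> two R t b l ->
  star j -> star l -> R t.
Proof.
move=> jl kj kl tj tl sj sl.
have sP := star_simP jl kj kl tj tl sj sl.
have /choice[p Hp] := star_rep sj; have /choice[q Hq] := star_rep sl.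
have pq x y x' y' : parmu (p x) (q y) (p x') (q y') = parmu x y x' y'.
  rewrite /parmu (mu_eq _ (proj2 (Hp x))) (mu_eq _ (proj2 (Hq y))).
  by rewrite (mu_eqr _ (proj2 (Hp x'))) (mu_eqr _ (proj2 (Hq y'))).
have clp : cl4 ops parmu.
  move=> a x y x' y' H.
  have /sP[_ _ _ _ P] : sim R j l (ops a [ffun i => p (x i)]) (ops a [ffun i => q (y i)])
      (ops a [ffun i => p (x' i)]) (ops a [ffun i => q (y' i)]).
    apply: (@clsim j l a (p \o x) (q \o y) (p \o x') (q \o y')) => c; apply/sP.
    by rewrite pq; split=> //=;
      by [case: (Hp (x c)) | case: (Hp (x' c)) | case: (Hq (y c)) | case: (Hq (y' c))].
  have mp z : mu (ops a [ffun i => z i]) (ops a [ffun i => p (z i)]).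
    by apply: (clmu (y := p \o z)) => c; case: (Hp (z c)).
  have mq z : mu (ops a [ffun i => z i]) (ops a [ffun i => q (z i)]).
    by apply: (clmu (y := q \o z)) => c; case: (Hq (z c)).
  rewrite /parmu (mu_eq _ (mp x)) (mu_eq _ (mq y)).
  by rewrite (mu_eqr _ (mp x')) (mu_eqr _ (mq y')).
rewrite tE; apply: (@move_close' j l k mu) => //.
- move=> x y x' y' H; apply/sP.
  split; try (by apply: fBs => c; have /sP[] := H c).
  by apply: (f_parmu clp) => c; have /sP[] := H c.
- by case: sj => thj _ _ x x' y xy x'y Bx Bx'; apply/thj => //; rewrite (mu_eqr _ x'y).
- move=> r Rr; have [Bp mp] := Hp (r k); have [y Ry] : exists y, R (upd2 r j l (p (r k)) y).
    exact: (two_move D1 D2 RDD nRt Rb jl kj kl).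
  by exists (p (r k)), y; rewrite upd2_neq // -(mu_eq _ mp) /mu eqxx.
Qed.

(** Fixing one entry of [sim j l] to [e] outside the class of [o2] gives [S01b], up to
    [mu]-representatives at [j]. Conversely, two triples of [S01b] sharing an entry recover
    [sim j l]. *)
Lemma star_01 j l k : j != l -> k != j -> k != l -> two R t b j -> two R t b l ->
  star j -> (forall x, Bs R l x <-> x != o2) -> (forall x y, th R l x y -> x = y) -> R t.
Proof.
move=> jl kj kl tj tl sj Bl thl.
have cl01 : cl1 ops (fun x => x != o2).
  by move=> a x H; apply/Bl; apply: clBs => c; apply/Bl.
have f01 := IH1 IH K1 cl01.
have [thj B2 [e e2 Be]] := sj.
have sP x y x' y' : sim R j l x y x' y' <->
    [/\ Bs R j x, y != o2, Bs R j x', y' != o2 & mu x x' == (y == y')].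
  split=> [S|[Bx /Bl By Bx' /Bl By' /eqP E]].
    have Bx := sim_Bl jl S; have By := sim_Br S.
    have Bx' := sim_Bl jl (sim_sym S); have By' := sim_Br (sim_sym S).
    split=> //; try exact/Bl.
    have [H1 H2] := sim_two D1 D2 RDD jl S.
    apply/eqP; apply/idP/eqP => [/(thj _ _ Bx Bx')/H1/thl//|E].
    by apply/(thj _ _ Bx Bx')/H2; rewrite E.
  apply: (two_sim D1 D2 RDD nRt Rb jl kj kl tj tl) => //.
  split=> [/(thj _ _ Bx Bx')|/thl/eqP]; first by rewrite E => /eqP <-.
  by rewrite -E => ?; apply/thj.
have /choice[p Hp] := star_rep sj.
have clS : cl3 ops S01b.
  move=> a y y' z H.
  have /sP[_ y1 _ y1' /eqP E] : sim R j l (ops a [ffun i => p (z i)]) (ops a [ffun i => y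
    i])
      (ops a [ffun i => e]) (ops a [ffun i => y' i]).
    apply: (@clsim j l a (p \o z) y (fun=> e) y') => c; apply/sP.
    case/and3P: (H c) => q1 q2 /eqP q3; have [Bp mp] := Hp (z c).
    split=> //=; rewrite q3 -(mu_eq _ mp) /mu (negbTE e2).
    by case: (z c == o2).
  have mp : mu (ops a [ffun i => z i]) (ops a [ffun i => p (z i)]).
    by apply: (clmu (y := p \o z)) => c; case: (Hp (z c)).
  have e2' : ops a [ffun i => e] != o2 by apply: (cl01 a (fun=> e)).
  rewrite /S01b y1 y1' -E -(mu_eq _ mp) /mu (negbTE e2').
  by case: (_ == o2).
have fS := f_S01 clS.
(* For [y] in {0, 1}, [u x y] is the element making [S01b y (u x y) x] hold: it encodes the class of
   [x] relative to [y]. *)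
pose s x := if x == o0 then o1 else o0.
pose u x y := if x == o2 then s y else y.
have Hu : all3 (fun x => all3 (fun y => all3 (fun x' => all3 (fun y' =>
    [&& y != o2, y' != o2 & mu x x' == (y == y')] ==>
    S01b y (u x y) x && S01b y' (u x y) x')))) by vm_compute.
have Hv : all3 (fun x => all3 (fun y => all3 (fun x' => all3 (fun y' => all3 (fun u =>
    S01b y u x && S01b y' u x' ==> [&& y != o2, y' != o2 & mu x x' == (y == y')])))))
  by vm_compute.
(* The tie ignores its second argument, so [l] can stand in for a third coordinate; [j] is moved to
   [e] in every row. *)
rewrite tE; apply: (@move_close' j l l (fun x _ => x != o2)) => //.
- by rewrite eq_sym.
- move=> x y x' y' H; apply/sP.
  have H' c : S01b (y c) (u (x c) (y c)) (x c) && S01b (y' c) (u (x c) (y c)) (x' c).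
    have /sP[_ h1 _ h2 h3] := H c.
    by have := all3P (all3P (all3P (all3P Hu (x c)) (y c)) (x' c)) (y' c); rewrite h1 h2 h3.
  have S1 := fS y (fun c => u (x c) (y c)) x (fun c => proj1 (andP (H' c))).
  have S2 := fS y' (fun c => u (x c) (y c)) x' (fun c => proj2 (andP (H' c))).
  have := all3P (all3P (all3P (all3P (all3P Hv (f [ffun c => x c])) (f [ffun c => y c]))
    (f [ffun c => x' c])) (f [ffun c => y' c])) (f [ffun c => u (x c) (y c)]).
  rewrite S1 S2 => /and3P[h1 h2 h3].
  by split=> //; apply: fBs => c; have /sP[] := H c.
- by move=> a x y H; apply: cl01.
- by move=> x y H; apply: f01.
- by move=> x x' _ x2 x2' Bx Bx'; apply/thj => //; rewrite /mu (negbTE x2) (negbTE x2').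
- move=> r Rr; have [y Ry] := two_move D1 D2 RDD nRt Rb jl kj kl tj tl Rr Be.
  by exists e, y.
Qed.

Lemma mu_two : (forall z, two R t b z) -> R t.
Proof.
move=> tw; have [j [l [k [jl kj kl]]]] := three_coords.
have lj : l != j by rewrite eq_sym.
have jk : j != k by rewrite eq_sym.
case: (mu_two_type jl (tw j)) => [[Bj thj]|sj];
  case: (mu_two_type lj (tw l)) => [[Bl thl]|sl].
- case: (mu_two_type kj (tw k)) => [[Bk thk]|sk].
    by apply: (same_type (i := o2) jl kj kl) => // x /Bk.
  by apply: (star_01 kj _ lj (tw k) (tw j) sk Bj thj); rewrite eq_sym.
- exact: (star_01 lj kl kj (tw l) (tw j) sl Bj thj).
- exact: (star_01 jl kj kl (tw j) (tw l) sj Bl thl).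
exact: all_star jl kj kl (tw j) (tw l) sj sl.
Qed.

(* The term condition for [(u, v) |-> D u o0 v]: it sends both [(o0, o2)] and
   [(o1, o2)] to [o2], but separates [(o0, o0)] from [(o1, o0)]. *)
Lemma beta_gamma_absurd j l : j != l -> non R j ->
  beta j l o0 o1 -> gamma j l o2 o0 -> False.
Proof.
move=> jl [_ thj] [x [x' [r [R0 R1]]]] [p [q [Rp Rq E pj qj]]].
have D102 : D o1 o0 o2 = o2.
  have : mu (D o1 o0 o2) (D o0 o0 o2) by apply: (cl2D clD clmu).
  by rewrite D2 /mu eqxx eqb_id => /eqP.
have thp : th R l (D x' x (p l)) (p l).
  exists p; rewrite upd_id; split=> //; have := RDD R1 R0 Rp; congr R.
  apply/funext=> k; rewrite /upd2 /upd; case: eqP => [->//|_].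
  by case: eqP => [->|_]; rewrite ?pj ?D102 ?D2.
suff : o1 = o0 by [].
apply: thj; exists q; split; last by rewrite -qj upd_id.
have : R (upd2 q j l o1 (D x' x (p l))).
  have := RDD R1 R0 Rq; congr R; apply/funext=> k; rewrite /upd2 /upd.
  by case: eqP => [->|_]; [rewrite E | case: eqP => [->|_]; rewrite ?qj ?D1 ?D2].
move=> /(th_upd D1 D2 RDD)/(_ thp); congr R.
by rewrite updC // E upd_id.
Qed.

(** [beta] relates 0 and 1 by [mu_least]. If [gamma] crossed the classes of [mu] it would be full by
    [mu_full], contradicting [beta_gamma_absurd]. *)
Lemma non_gamma j l : j != l -> non R j -> forall x y, gamma j l x y -> mu x y.
Proof.
move=> jl nj; have [Bj thj] := nj.
have bt : beta j l o0 o1.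
  apply: (mu_least (@cl2_beta j l)) (beta_tb jl); first by move=> x; apply: beta_refl.
  exact: (t_neq_b D1 D2 RDD nRt Rb jl).
have rg x : gamma j l x x by apply: gamma_refl.
have n2 x : x <> o2 -> ~ gamma j l x o2.
  move=> x2 g; apply: (beta_gamma_absurd jl nj bt).
  exact: (mu_full (@cl2_gamma j l) rg x2 g).
have sg := cl2_refl_sym D1 D2 clD (@cl2_gamma j l) rg.
move=> x y g; have gs := sg _ _ g; rewrite /mu.
have [x2|/eqP x2] := eqVneq x o2; have [y2|/eqP y2] := eqVneq y o2 => //.
  by case: (n2 y y2); rewrite -x2.
by case: (n2 x x2); rewrite -y2.
Qed.

Lemma non_tb j : non R j -> t j != o2 /\ b j != o2.
Proof.
move=> nj; have [l [lj _]] := exists_third j j K3; have [k [kj kl]] := exists_third j l K3.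
have jl : j != l by rewrite eq_sym.
have := non_gamma jl nj (gamma_tb jl kj kl); have := t_neq_b D1 D2 RDD nRt Rb jl.
rewrite /mu; have [->|_] := eqVneq (t j) o2; have [->|_] := eqVneq (b j) o2; by [].
Qed.

(** A tuple with [o2] at [j] and [t l] or [b l] at [l] would be linked by [gamma] to [b j] or [t j],
    which lie in the other class. *)
Lemma non_tie2 j l r : j != l -> non R j -> R r -> r j = o2 -> r l <> t l /\ r l <> b l.
Proof.
move=> jl nj Rr rj; have [t2 b2] := non_tb nj.
split=> E.
  have : gamma j l o2 (b j) by exists r, (upd t j (b j)); rewrite upd_eq upd_neq // eq_sym.
  by move/(non_gamma jl nj); rewrite /mu (negbTE b2).
have : gamma j l o2 (t j) by exists r, (upd t l (b l)); rewrite upd_eq upd_neq.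
by move/(non_gamma jl nj); rewrite /mu (negbTE t2).
Qed.

Lemma non_all j l : j != l -> non R j -> non R l.
Proof.
move=> jl nj; have lj : l != j by rewrite eq_sym.
have [tl|nl] := two_or_non lj; last exact: nl.
have [r Rr rj] := Bs_ex (proj1 nj o2).
have rj' v : upd r l v j = o2 by rewrite upd_neq.
by case: (tl _ (Bs_of l Rr)) => /(th_sub D1 D2 RDD Rr) Rr';
  case: (non_tie2 jl nj Rr' (rj' _)); rewrite upd_eq.
Qed.

(** [t l] and [b l] are distinct elements of {0, 1}, so by [non_tie2] only [o2] is left at [l]. *)
Lemma non_tie j l r : j != l -> non R j -> R r -> (r j == o2) = (r l == o2).
Proof.
suff half j' l' : j' != l' -> non R j' -> R r -> r j' = o2 -> r l' = o2.
  move=> jl nj Rr; apply/eqP/eqP; first exact: half.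
  by apply: half; rewrite // 1?eq_sym //; apply: non_all nj.
move=> jl nj Rr rj; have lj : l' != j' by rewrite eq_sym.
have nl := non_all jl nj; have [t2 b2] := non_tb nl.
have [rt rb] := non_tie2 jl nj Rr rj.
have tb := t_neq_b D1 D2 RDD nRt Rb lj.
by case: (I3_cover (r l') (nesym (elimN eqP t2)) (nesym (elimN eqP b2)) tb).
Qed.

Lemma mu_non : (exists j, non R j) -> R t.
Proof.
case=> j nj; have [l [lj _]] := exists_third j j K3;
  have [k [kj kl]] := exists_third j l K3.
have jl : j != l by rewrite eq_sym.
have jk : j != k by rewrite eq_sym.
have nl := non_all jl nj; have [Bj thj] := nj; have [Bl thl] := nl.
have cov z z' x : z != z' -> non R z -> x != o2 -> x = t z \/ x = b z.
  move=> zz' nz x2; have [t2 b2] := non_tb nz; have tb := t_neq_b D1 D2 RDD nRt Rb zz'.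
  case: (I3_cover x (nesym (elimN eqP t2)) (nesym (elimN eqP b2)) tb) => E;
    [|by left|by right].
  by rewrite E eqxx in x2.
have sP x y x' y' : sim R j l x y x' y' <-> par2 x y x' y'.
  split=> [S|].
    (* The value at [k] is common to the two tuples and shows whether all four entries are [o2] or
       none is. *)
    have [r [Rr Rr']] := S.
    have := non_tie jl nj Rr; have := non_tie jk nj Rr; have := non_tie jl nj Rr';
      have := non_tie jk nj Rr'.
    rewrite !upd2_1 // !upd2_2 !upd2_neq // => E1 E2 E3 E4.
    have E : (x == x') = (y == y').
      apply/eqP/eqP => E.
        by apply: thl; apply: (@sim_thr _ _ _ j l x); rewrite {2}E.
      by apply: thj; apply: (@sim_thl _ _ _ j l x y) => //; rewrite {2}E.
    rewrite /par2 /par -E4 -E2 E1 E3 E eqxx.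
    by case: (r k == o2).
  have S1 : sim R j l (t j) (t l) (b j) (b l).
    apply: (sim_ttbb D1 D2 RDD nRt Rb jl kj kl) => y0 Ry.
    have [//|->|->] := cov l j y0 lj nl; [|left; exact: (proj1 nl)|right;
      exact: (proj1 nl)].
    have := non_tie jl nj Ry; rewrite upd2_1 // upd2_2 => <-; exact: (proj2 (non_tb nj)).
  have S2 := sim_btb Rb jl.
  have rS u v u1 v1 : sim R j l u v u1 v1 -> sim R j l u v u v.
    by move=> S; apply: sim_trans D1 D2 RDD _ _ _ _ _ _ _ _ S (sim_sym S).
  case/orP=> [/and5P[x2 y2 x2' y2' /eqP E]|/and4P[/eqP-> /eqP-> /eqP-> /eqP->]].
    have tbj := t_neq_b D1 D2 RDD nRt Rb jl; have tbl := t_neq_b D1 D2 RDD nRt Rb lj.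
    have [[tbj1 tbj2] [tbl1 tbl2]] := (introN eqP tbj, introN eqP (nesym tbj),
      (introN eqP tbl, introN eqP (nesym tbl))).
    case: (cov _ _ _ jl nj x2) (cov _ _ _ lj nl y2) (cov _ _ _ jl nj x2') (cov _ _ _ lj
      nl y2') E
      => -> [] -> [] -> [] ->;
    by rewrite ?eqxx ?(negbTE tbj1) ?(negbTE tbj2) ?(negbTE tbl1) ?(negbTE tbl2) // => _;
      by [apply: rS S1 | apply: rS (sim_sym S1) | apply: rS S2 | apply: rS (sim_sym S2)
       | apply: S1 | apply: S2 | apply: sim_sym S1 | apply: sim_sym S2].
  have [r Rr rj] := Bs_ex (Bj o2); have := non_tie jl nj Rr.
  rewrite rj eqxx => /esym/eqP rl; rewrite -{1 3}rj -rl; exact: sim_of.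
have clp : cl4 ops par2.
  by move=> a x y x' y' H; apply/sP; apply: clsim => c; apply/sP.
have fp := f_par2 clp.
rewrite tE; apply: (@move_close' j l k eq) => //.
- by move=> x y x' y' H; apply/sP; apply: fp => c; apply/sP.
- by move=> a; apply: pr2_eq.
- exact: pr2_eq.
- by move=> x x' y -> ->.
- move=> r Rr; suff [y Hy] : exists y, par2 (r j) (r l) (r k) y.
    exists (r k), y; rewrite upd2_neq //; split=> //.
    by apply: (sim_sub D1 D2 RDD) => //; apply/sP.
  have := non_tie jl nj Rr; have := non_tie jk nj Rr.
  move: (r j) (r l) (r k); do 3!apply: I3_ind; move=> // _ _;
    by [exists o0 | exists o1 | exists o2].
Qed.

Lemma mu_step : R t.
Proof.
have [|nn] := EM (exists j, non R j); first exact: mu_non.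
apply: mu_two => z; have [k [kz _]] := exists_third z z K3.
have zk : z != k by rewrite eq_sym.
by have [//|nz] := two_or_non zk; case: nn; exists z.
Qed.

End Monolith.

End ThreeElements.

(** * Binary relations *)

Definition eq2 (P Q : 'I_3 -> 'I_3 -> bool) := all3 (fun x => all3 (fun y => P x y == Q x
  y)).

Lemma eq2P P Q : eq2 P Q -> P = Q.
Proof.
by move=> H; apply/funext=> x; apply/funext=> y; apply/eqP; apply: (all3P (all3P H x) y).
Qed.

Definition relb (s : seq (seq nat)) (x y : 'I_3) := [:: x : nat; y : nat] \in s.

Definition pairb (a b c d x y : 'I_3) := (x == a) && (y == b) || (x == c) && (y == d).

(** On three elements, the graph of the transposition fixing [i]; it is stated for any [eqType] to
    make sense before the algebra is labelled. *)
Definition psi_ (T : eqType) (i x y : T) := if x == i then y == i else (y != i) && (y != x).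

Definition phil := [:: [:: 0; 1]; [:: 1; 2]; [:: 2; 0]].
Definition psi2l := [:: [:: 0; 1]; [:: 1; 0]; [:: 2; 2]].
Definition psi2l' := [:: [:: 0; 1]; [:: 1; 0]].
Definition tau0l := [:: [:: 0; 0]; [:: 1; 0]; [:: 2; 1]].
Definition tau1l := [:: [:: 0; 1]; [:: 1; 1]; [:: 2; 0]].

Definition binlist1 : seq (seq (seq nat)) :=
  [:: phil; psi2l; [:: [:: 1; 2]; [:: 2; 1]]; [:: [:: 0; 2]; [:: 2; 0]]; psi2l';
      [:: [:: 1; 2]; [:: 2; 0]]; [:: [:: 0; 1]; [:: 2; 0]]; [:: [:: 0; 1]; [:: 1; 2]];
      [:: [:: 1; 2]; [:: 0; 0]]; [:: [:: 0; 2]; [:: 1; 1]]; [:: [:: 0; 1]; [:: 2; 2]]].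

Section Binary.
Variables (I : Type) (ar : I -> nat) (ops : forall i, op 'I_3 (ar i)).
Variable D : 'I_3 -> 'I_3 -> 'I_3 -> 'I_3.
Hypothesis D1 : forall x y, D y x x = y.
Hypothesis D2 : forall x y, D x x y = y.
Hypothesis clD : forall (K : finType) (P : (K -> 'I_3) -> Prop), clK ops P ->
  forall r1 r2 r3, P r1 -> P r2 -> P r3 -> P (fun k => D (r1 k) (r2 k) (r3 k)).
Variables (n : nat) (f : op 'I_3 n).
Hypothesis f1 : forall P, cl1 ops P -> pr1 f P.

Definition good (P : 'I_3 -> 'I_3 -> bool) := cl2 ops P -> pr2 f P.

Lemma good_sym (P : 'I_3 -> 'I_3 -> bool) : good (fun x y => P y x) -> good P.
Proof. by move=> g cP; apply: (pr2_sym (g _)) => i; apply: (pr2_sym (cP i)). Qed.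

Lemma good_diag (P : 'I_3 -> 'I_3 -> bool) : (forall x y, P x y -> x = y) -> good P.
Proof.
move=> PE cP x y H.
have -> : y = x by apply/funext=> i; rewrite (PE _ _ (H i)).
apply: (f1 (P := fun x => P x x)) => [i z Hz|i]; first exact: cP.
by have := H i; rewrite (PE _ _ (H i)).
Qed.

Section Listed1.
Hypothesis gl : forall s, s \in binlist1 -> good (relb s).

Lemma good_has P : has (fun s => eq2 P (relb s)) binlist1 -> good P.
Proof. by case/hasP=> s sl /eq2P->; apply: gl. Qed.

(** By enumeration, a bijection between two-element subsets is part of the identity, listed, or the
    inverse of a listed one. *)
Lemma good_pair a b c d : a != c -> b != d -> good (pairb a b c d).
Proof.
move=> ac bd.
have H : all3 (fun a => all3 (fun b => all3 (fun c => all3 (fun d => (a != c) && (b != d)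
  ==>
  [|| (a == b) && (c == d), has (fun s => eq2 (pairb a b c d) (relb s)) binlist1 |
      has (fun s => eq2 (fun x y => pairb a b c d y x) (relb s)) binlist1])))) by
        vm_compute.
have := all3P (all3P (all3P (all3P H a) b) c) d.
rewrite ac bd => /or3P[/andP[/eqP-> /eqP->]|/good_has//|/good_has/good_sym//].
by apply: good_diag => x y /orP[]/andP[/eqP-> /eqP->].
Qed.

Hypothesis psi0_2 : cl2 ops (psi_ o0) -> cl2 ops (psi_ o2).
Hypothesis psi1_2 : cl2 ops (psi_ o1) -> cl2 ops (psi_ o2).

Let comp (P Q : 'I_3 -> 'I_3 -> bool) x z :=
  [|| P x o0 && Q o0 z, P x o1 && Q o1 z | P x o2 && Q o2 z].

Let pr2_compb m (g : op 'I_3 m) (P Q : 'I_3 -> 'I_3 -> bool) : pr2 g P -> pr2 g Q -> pr2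
  g (comp P Q).
Proof.
move=> gP gQ; have := pr2_comp gP gQ; congr pr2.
apply/funext=> x; apply/funext=> z; apply/propext; split.
  case=> y [Pxy Qyz]; rewrite /comp.
  by case: (I3_cases y) Pxy Qyz => -> -> ->; rewrite ?orbT.
by case/or3P=> /andP[? ?]; [exists o0 | exists o1 | exists o2].
Qed.

(** Up to inverse only [psi_ o0] and [psi_ o1] are not listed and not the identity. If one of them
    is invariant, so is [psi_ o2] by the choice of labelling, and then so is [phi]; the given
    transposition is a composite of these two listed relations. *)
Lemma good_perm p : injective p -> good (fun x y => y == p x).
Proof.
move=> pI.
pose q p0 p1 p2 (x y : 'I_3) := y == if x == o0 then p0 else if x == o1 then p1 else p2.
have H : all3 (fun p0 => all3 (fun p1 => all3 (fun p2 => uniq [:: p0; p1; p2] ==>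
  [|| eq2 (q p0 p1 p2) eq_op, has (fun s => eq2 (q p0 p1 p2) (relb s)) binlist1,
      has (fun s => eq2 (fun x y => q p0 p1 p2 y x) (relb s)) binlist1,
      eq2 (q p0 p1 p2) (psi_ o0) | eq2 (q p0 p1 p2) (psi_ o1)]))) by vm_compute.
have := all3P (all3P (all3P H (p o0)) (p o1)) (p o2).
have -> : q (p o0) (p o1) (p o2) = (fun x y => y == p x).
  by apply/funext=> x; apply/funext=> y; rewrite /q; move: x; apply: I3_ind.
have -> : uniq [:: p o0; p o1; p o2] by rewrite /= !inE !(inj_eq pI).
have psiE : psi_ o2 = relb psi2l by apply: eq2P; vm_compute.
have fpsi : cl2 ops (psi_ o2) -> pr2 f (psi_ o2) by rewrite psiE; apply: gl.
have fphi : cl2 ops (relb phil) -> pr2 f (relb phil) by apply: gl.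
case/or4P=> [/eq2P->|/good_has//|/good_has/good_sym//|/orP[]/eq2P->].
- by apply: good_diag => x y /eqP.
- move=> c0; have c2 := psi0_2 c0.
  have cphi : cl2 ops (relb phil).
    have -> : relb phil = comp (psi_ o0) (psi_ o2) by apply: eq2P; vm_compute.
    by move=> i; apply: pr2_compb.
  have -> : psi_ o0 = comp (relb phil) (psi_ o2) by apply: eq2P; vm_compute.
  by apply: pr2_compb; [apply: fphi | apply: fpsi].
move=> c1; have c2 := psi1_2 c1.
have cphi : cl2 ops (relb phil).
  have -> : relb phil = comp (psi_ o2) (psi_ o1) by apply: eq2P; vm_compute.
  by move=> i; apply: pr2_compb.
have -> : psi_ o1 = comp (psi_ o2) (relb phil) by apply: eq2P; vm_compute.
by apply: pr2_compb; [apply: fpsi | apply: fphi].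
Qed.

End Listed1.

Variables (K : finType) (R : (K -> 'I_3) -> Prop).
Hypothesis clR : clK ops R.
Variables t b : K -> 'I_3.
Hypothesis nRt : ~ R t.
Hypothesis Rb : forall z, R (upd t z (b z)).
Variable rows : 'I_n -> K -> 'I_3.
Hypothesis Rrows : forall i, R (rows i).
Hypothesis tE : t = fun k => f [ffun i => rows i k].

Let RDD := RD clD clR.

Definition only j l := forall k : K, k = j \/ k = l.
(** [R] as a binary relation; when [j] and [l] are the only coordinates, [t] is a mere carrier, both
    its values being overwritten. *)
Definition Rp j l x y := R (upd2 t j l x y).

Lemma RpE j l r : only j l -> R r <-> Rp j l (r j) (r l).
Proof.
move=> jlK; rewrite /Rp upd2E // => k kj kl.
by case: (jlK k) => E; [rewrite E eqxx in kj | rewrite E eqxx in kl].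
Qed.

Lemma cl2_Rp j l : j != l -> only j l -> cl2 ops (Rp j l).
Proof.
move=> jl jlK i x y H; have := clR H; congr R.
apply/funext=> k; rewrite /upd2 /upd; case: eqP => kl; first by [].
by case: eqP => // kj; case: (jlK k).
Qed.

Lemma Rp_absurd j l (P : 'I_3 -> 'I_3 -> bool) : only j l ->
  (forall x y, Rp j l x y -> P x y) -> pr2 f P -> P (t j) (t l).
Proof.
move=> jlK RP fP; have tz z : t z = f [ffun i => rows i z] by rewrite tE.
by rewrite !tz; apply: fP => i; apply: RP; apply: (proj1 (RpE _ jlK)).
Qed.

Lemma Rp_th j l x x' y : j != l -> Rp j l x y -> Rp j l x' y -> th R j x x'.
Proof.
by move=> jl R1 R2; exists (upd t l y); rewrite -!(updC _ _ _ jl).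
Qed.

Lemma Rp_thr j l x y y' : Rp j l x y -> Rp j l x y' -> th R l y y'.
Proof. by move=> R1 R2; exists (upd t j x). Qed.

Lemma non_graph j l : j != l -> only j l -> non R j ->
  exists2 p, injective p & forall x y, Rp j l x y <-> y = p x.
Proof.
move=> jl jlK [Bj thj].
have /choice[p Hp] : forall x, exists y, Rp j l x y.
  by move=> x; have [r Rr <-] := Bs_ex (Bj x); exists (r l); apply: (proj1 (RpE r jlK)).
have fib x x' y : Rp j l x y -> Rp j l x' y -> x = x' by move=> *; apply: thj;
  apply: Rp_th; eassumption.
have pI : injective p by move=> x x' E; apply: fib (Hp x) _; rewrite E.
exists p => // x y; split=> [H|->//].
have Ey : y = p (invF pI y) by rewrite f_invF.
by rewrite Ey; congr p; apply: fib (Hp _) _; rewrite -Ey.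
Qed.

(** A pair equivalent to [(t j, t l)] would put [t] in [R]; one equivalent to [(b j, b l)] would
    make [t l] and [b l] fork over [b j]. So [R] is a bijection of the fork quotients. *)
Lemma Rp_two j l : j != l -> only j l -> two R t b j -> two R t b l ->
  forall x y, Rp j l x y ->
  (th R j x (b j) /\ th R l y (t l)) \/ (th R j x (t j) /\ th R l y (b l)).
Proof.
move=> jl jlK tj tl x y Rxy.
have Bx : Bs R j x by have := Bs_of j Rxy; rewrite upd2_1.
have By : Bs R l y by have := Bs_of l Rxy; rewrite upd2_2.
have mv x' y' : th R j x x' -> th R l y y' -> Rp j l x' y'.
  move=> xx' yy'; apply: (sim_upd D1 D2 RDD Rxy).
  by apply: (sim_refl_th D1 D2 RDD) => //; exists t.
case: (tj x Bx) (tl y By) => [xt|xb] [yt|yb]; [|by right|by left|]; exfalso.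
  by apply: nRt; have := mv _ _ xt yt; rewrite /Rp upd2_id.
apply: (not_th_tb D1 D2 RDD nRt Rb (z := l)); apply: Rp_thr (mv _ _ xb yb).
by rewrite /Rp /upd2 updC // upd_id.
Qed.

Lemma graph_absurd j l : j != l -> only j l -> non R j ->
  (forall p, injective p -> cl2 ops (fun x y => y == p x) -> pr2 f (fun x y => y == p x)) ->
  False.
Proof.
move=> jl jlK nj gp; have [p pI pE] := non_graph jl jlK nj.
have E : Rp j l = (fun x y => y == p x).
  apply/funext=> x; apply/funext=> y; apply/propext.
  by split=> [/pE->|/eqP]; [exact: eqxx | move/pE].
have /eqP/pE : t l == p (t j).
  by apply: (Rp_absurd (P := fun x y => y == p x) jlK);
    [rewrite E | apply: gp => //; rewrite -E; apply: cl2_Rp].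
by rewrite /Rp upd2_id.
Qed.

Lemma pair_absurd j l : j != l -> only j l -> two R t b j -> two R t b l ->
  (forall x y, th R j x y -> x = y) -> (forall x y, th R l x y -> x = y) ->
  good (pairb (b j) (t l) (t j) (b l)) -> False.
Proof.
move=> jl jlK tj tl thj thl gP; have lj : l != j by rewrite eq_sym.
have tbj := introN eqP (t_neq_b D1 D2 RDD nRt Rb jl).
have tbl := introN eqP (t_neq_b D1 D2 RDD nRt Rb lj).
pose P := pairb (b j) (t l) (t j) (b l).
have RP x y : Rp j l x y -> P x y.
  by case/(Rp_two jl jlK tj tl) => -[/thj-> /thl->]; rewrite /P /pairb !eqxx ?orbT.
have E : Rp j l = P.
  apply/funext=> x; apply/funext=> y; apply/propext; split; first exact: RP.
  case/orP=> /andP[/eqP-> /eqP->]; last by rewrite /Rp /upd2 upd_id.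
  by rewrite /Rp /upd2 updC // upd_id.
have : P (t j) (t l).
  by apply: (Rp_absurd jlK RP); apply: gP;
    rewrite -[fun x y => _]/(fun x y => P x y : Prop) -E; apply: cl2_Rp.
by rewrite /P /pairb (negbTE tbj) (negbTE tbl) andbF.
Qed.

(** * Binary relations of simple algebras *)

Section SimpleBinary.
Hypothesis simp : forall E : 'I_3 -> 'I_3 -> Prop, cl2 ops E -> (forall x, E x x) ->
  forall x y, x <> y -> E x y -> forall x' y', E x' y'.
Hypothesis good_pair' : forall a b c d, a != c -> b != d -> good (pairb a b c d).
Hypothesis good_perm' : forall p, injective p -> good (fun x y => y == p x).

Lemma simple_binary j l : j != l -> only j l -> False.
Proof.
move=> jl jlK; have lj : l != j by rewrite eq_sym.
have ljK : only l j by move=> k; case: (jlK k); auto.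
have tw z z' : z != z' -> only z z' -> two R t b z.
  move=> zz' zK; have [//|nz] := two_or_non D1 D2 clD clR nRt Rb zz'.
  by exfalso; apply: (graph_absurd zz' zK nz) => p pI; apply: good_perm'.
have tj := tw _ _ jl jlK; have tl := tw _ _ lj ljK.
have [ij [_ thj]] := simple_two_type D1 D2 clD clR nRt Rb simp jl tj.
have [il [_ thl]] := simple_two_type D1 D2 clD clR nRt Rb simp lj tl.
have tbj := introN eqP (t_neq_b D1 D2 RDD nRt Rb jl).
have tbl := introN eqP (t_neq_b D1 D2 RDD nRt Rb lj).
apply: (pair_absurd jl jlK tj tl thj thl).
by apply: good_pair' => //; rewrite eq_sym.
Qed.

End SimpleBinary.

(** * Binary relations of algebras with monolith mu_2 *)

Section MonolithBinary.
Hypothesis clmu : cl2 ops mu.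
Hypothesis g_mu : good mu.
Hypothesis g_rho : good (fun x y => ~~ mu x y).
Hypothesis g_tau0 : good (relb tau0l).
Hypothesis g_tau1 : good (relb tau1l).
Hypothesis g_psi : good (relb psi2l).
Hypothesis g_psi' : good (relb psi2l').

(** The pullback of [mu] along an automorphism is again a nontrivial congruence, hence contains
    [(o0, o1)]. This leaves the identity and [psi2]. *)
Lemma mu_good_perm p : injective p -> good (fun x y => y == p x).
Proof.
move=> pI cp.
have /eqP p01 : mu (p o0) (p o1).
  apply: (mu_least D1 D2 clD clmu (E := fun x y => mu (p x) (p y)) (x := invF pI o0) (y
    := invF pI o1)).
  - move=> i x y H.
    have pE z : ops i [ffun a => p (z a)] = p (ops i [ffun a => z a]).
      by apply/eqP; apply: (cp i z (p \o z)) => a /=.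
    by rewrite -!pE; apply: (clmu (x := p \o x) (y := p \o y)).
  - by move=> x; rewrite /mu.
  - by move=> E; have := f_invF pI o0; rewrite E f_invF.
  - by rewrite !f_invF.
pose q p0 p1 p2 (x y : 'I_3) := y == if x == o0 then p0 else if x == o1 then p1 else p2.
have H : all3 (fun p0 => all3 (fun p1 => all3 (fun p2 => uniq [:: p0; p1;
  p2] && mu p0 p1 ==>
  (eq2 (q p0 p1 p2) eq_op || eq2 (q p0 p1 p2) (relb psi2l))))) by vm_compute.
have := all3P (all3P (all3P H (p o0)) (p o1)) (p o2).
have qE : q (p o0) (p o1) (p o2) = (fun x y => y == p x).
  by apply/funext=> x; apply/funext=> y; rewrite /q; move: x; apply: I3_ind.
rewrite qE; have -> : uniq [:: p o0; p o1; p o2] by rewrite /= !inE !(inj_eq pI).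
rewrite /mu p01 eqxx /= => /orP[]/eq2P E; move: cp; rewrite -/(good _) E //.
by apply: good_diag => x y /eqP.
Qed.

(** The projection at [j] may be a mere transversal, so [R] is first composed with [mu]; the result
    is [tau0] or [tau1], and it still excludes [t]. *)
Lemma star_01_absurd j l : j != l -> only j l -> two R t b j -> two R t b l ->
  star R j -> (forall x, Bs R l x <-> x != o2) -> (forall x y, th R l x y -> x = y) ->
    False.
Proof.
move=> jl jlK tj tl [thj B2 _] Bl thl; have lj : l != j by rewrite eq_sym.
have tbj := not_th_tb D1 D2 RDD nRt Rb (z := j).
have tbl := introN eqP (t_neq_b D1 D2 RDD nRt Rb lj).
have thmu x y : th R j x y -> mu x y by move=> H; apply/thj => //;
  [exact: th_Bl H | exact: th_Br H].
have mtb : mu (t j) (b j) = false.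
  by apply/negP=> /thj H; apply: tbj; apply: H; [exact: (Bs_t Rb jl) | exact: (Bs_b Rb)].
pose P x y := mu x (b j) && (y == t l) || mu x (t j) && (y == b l).
have RP x y : Rp j l x y -> P x y.
  by case/(Rp_two jl jlK tj tl) => -[/thmu m /thl->]; rewrite /P m !eqxx ?orbT.
have mE x y z : mu x y -> mu y z = mu x z by rewrite /mu => /eqP->.
have cP : cl2 ops P.
  have -> : (fun x y => P x y : Prop) = (fun x y => exists x', mu x x' /\ Rp j l x' y).
    apply/funext=> x; apply/funext=> y; apply/propext; split=> [|[x' [m /RP]]].
      case/orP=> /andP[m /eqP->]; [exists (b j) | exists (t j)]; split=> //.
        by rewrite /Rp /upd2 updC // upd_id.
      by rewrite /Rp /upd2 upd_id.
    by rewrite /P !(mE _ _ _ m).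
  by move=> i; apply: pr2_comp => //; apply: cl2_Rp.
have H : all3 (fun tj => all3 (fun bj => all3 (fun tl => all3 (fun bl =>
    [&& ~~ mu tj bj, tl != bl, tl != o2 & bl != o2] ==>
    (let P x y := mu x bj && (y == tl) || mu x tj && (y == bl) in
     eq2 P (relb tau0l) || eq2 P (relb tau1l)))))) by vm_compute.
have := all3P (all3P (all3P (all3P H (t j)) (b j)) (t l)) (b l).
have t2 : t l != o2 by apply/Bl; exact: (Bs_t Rb lj).
have b2 : b l != o2 by apply/Bl; exact: (Bs_b Rb).
rewrite mtb tbl t2 b2 /= -/P => gP.
have : P (t j) (t l).
  by apply: (Rp_absurd jlK RP); case/orP: gP cP => /eq2P->; [apply: g_tau0 | apply: g_tau1].
by rewrite /P mtb (negbTE tbl) andbF.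
Qed.

(** Composing [R] with [mu] on both sides gives a bijection between the two classes of [mu], that
    is, [mu] or its complement. *)
Lemma star_star_absurd j l : j != l -> only j l -> two R t b j -> two R t b l ->
  star R j -> star R l -> False.
Proof.
move=> jl jlK tj tl [thj _ _] [thl _ _]; have lj : l != j by rewrite eq_sym.
have thmuj x y : th R j x y -> mu x y by move=> H; apply/thj => //;
  [exact: th_Bl H | exact: th_Br H].
have thmul x y : th R l x y -> mu x y by move=> H; apply/thl => //;
  [exact: th_Bl H | exact: th_Br H].
have mtbj : mu (t j) (b j) = false.
  by apply/negP=> /thj H; apply: (not_th_tb D1 D2 RDD nRt Rb (z := j)); apply: H;
    [exact: (Bs_t Rb jl) | exact: (Bs_b Rb)].
have mtbl : mu (t l) (b l) = false.
  by apply/negP=> /thl H; apply: (not_th_tb D1 D2 RDD nRt Rb (z := l)); apply: H;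
    [exact: (Bs_t Rb lj) | exact: (Bs_b Rb)].
pose P x y := mu x (b j) && mu y (t l) || mu x (t j) && mu y (b l).
have RP x y : Rp j l x y -> P x y.
  by case/(Rp_two jl jlK tj tl) => -[/thmuj m /thmul m']; rewrite /P m m' ?orbT.
have mE x y z : mu x y -> mu y z = mu x z by rewrite /mu => /eqP->.
have mC x y : mu x y = mu y x by rewrite /mu eq_sym.
have cP : cl2 ops P.
  have -> : (fun x y => P x y : Prop) =
      (fun x y => exists x', mu x x' /\ exists y', Rp j l x' y' /\ mu y' y).
    apply/funext=> x; apply/funext=> y; apply/propext; split=> [|[x' [m [y' [/RP H m']]]]].
      case/orP=> /andP[m m']; [exists (b j) | exists (t j)]; split=> //;
        [exists (t l) | exists (b l)]; rewrite mC; split=> //.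
        by rewrite /Rp /upd2 updC // upd_id.
      by rewrite /Rp /upd2 upd_id.
    by move: H; rewrite /P !(mE _ _ _ m) -!(mE _ _ _ m').
  move=> i; apply: pr2_comp; first exact: clmu.
  by apply: pr2_comp; [apply: cl2_Rp | apply: clmu].
have H : all3 (fun tj => all3 (fun bj => all3 (fun tl => all3 (fun bl =>
    ~~ mu tj bj && ~~ mu tl bl ==>
    (let P x y := mu x bj && mu y tl || mu x tj && mu y bl in
     eq2 P mu || eq2 P (fun x y => ~~ mu x y)))))) by vm_compute.
have := all3P (all3P (all3P (all3P H (t j)) (b j)) (t l)) (b l).
rewrite mtbj mtbl /= -/P => gP.
have : P (t j) (t l).
  by apply: (Rp_absurd jlK RP); case/orP: gP cP => /eq2P->; [apply: g_mu | apply: g_rho].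
by rewrite /P mtbj mtbl andbF.
Qed.

Lemma mu_binary j l : j != l -> only j l -> False.
Proof.
move=> jl jlK; have lj : l != j by rewrite eq_sym.
have ljK : only l j by move=> k; case: (jlK k); auto.
have tw z z' : z != z' -> only z z' -> two R t b z.
  move=> zz' zK; have [//|nz] := two_or_non D1 D2 clD clR nRt Rb zz'.
  by exfalso; apply: (graph_absurd zz' zK nz) => p pI; apply: mu_good_perm.
have tj := tw _ _ jl jlK; have tl := tw _ _ lj ljK.
have ty z z' (zz' : z != z') := mu_two_type D1 D2 clD clR nRt Rb clmu zz'.
case: (ty _ _ jl tj) (ty _ _ lj tl) => [[Bj thj]|sj] [[Bl thl]|sl].
- apply: (pair_absurd jl jlK tj tl thj thl).
  have H : all3 (fun a => all3 (fun b => all3 (fun c => all3 (fun d =>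
      [&& a != c, b != d, a != o2 & b != o2] && ((c != o2) && (d != o2)) ==>
      ((a == b) && (c == d) || eq2 (pairb a b c d) (relb psi2l')))))) by vm_compute.
  have := all3P (all3P (all3P (all3P H (b j)) (t l)) (t j)) (b l).
  have [tj2 bj2] : t j != o2 /\ b j != o2.
    by split; apply/Bj; [exact: (Bs_t Rb jl) | exact: (Bs_b Rb)].
  have [tl2 bl2] : t l != o2 /\ b l != o2.
    by split; apply/Bl; [exact: (Bs_t Rb lj) | exact: (Bs_b Rb)].
  have tbj := introN eqP (nesym (t_neq_b D1 D2 RDD nRt Rb jl)).
  have tbl := introN eqP (t_neq_b D1 D2 RDD nRt Rb lj).
  rewrite tj2 bj2 tl2 bl2 tbj tbl => /orP[/andP[/eqP-> /eqP->]|/eq2P->//].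
  by apply: good_diag => x y /orP[]/andP[/eqP-> /eqP->].
- exact: star_01_absurd lj ljK tl tj sl Bj thj.
- exact: star_01_absurd jl jlK tj tl sj Bl thl.
exact: star_star_absurd jl jlK tj tl sj sl.
Qed.

End MonolithBinary.

End Binary.

(** * The listed relations and the classification *)

(** Membership in [mu_ e], for any [eqType] so that it can be stated before the algebra is
    labelled. *)
Definition mue (T : eqType) (e x y : T) := (x == e) == (y == e).

Lemma preservesP (T : finType) n (g : op T n) m (R : rel_on T m) :
  preserves g R <-> prs g (fun r : 'I_m -> T => [ffun i => r i] \in R).
Proof.
split=> H rows Hr.
  have := H [ffun j => [ffun i => rows j i]].
  rewrite (_ : [ffun i => _] = [ffun i => g [ffun j => rows j i]]); last first.
    by apply/ffunP=> i; rewrite !ffunE; congr (g _); apply/ffunP=> j; rewrite !ffunE.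
  by apply=> j; rewrite ffunE.
apply: (H (fun j => rows j)) => j.
by rewrite (_ : [ffun i => _] = rows j) //; apply/ffunP=> i; rewrite ffunE.
Qed.

Lemma preserves2 n (g : op 'I_3 n) (R : rel_on 'I_3 2) (P : 'I_3 -> 'I_3 -> bool) :
  (forall x, (x \in R) = P (x (@Ordinal 2 0 isT)) (x (@Ordinal 2 1 isT))) ->
  preserves g R <-> pr2 g P.
Proof.
move=> RP; rewrite preservesP; split=> H.
  move=> x y Pxy.
  have := H (fun j (i : 'I_2) => nth o0 [:: x j; y j] i).
  rewrite RP !ffunE => H'; apply: H' => j.
  by rewrite RP !ffunE; apply: Pxy.
by move=> rows Hr; rewrite RP !ffunE; apply: H => j; have := Hr j; rewrite RP !ffunE.
Qed.

Lemma preserves3 n (g : op 'I_3 n) (R : rel_on 'I_3 3) (P : 'I_3 -> 'I_3 -> 'I_3 -> bool) :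
  (forall x, (x \in R) = P (x o0) (x o1) (x o2)) ->
  preserves g R <-> pr3 g P.
Proof.
move=> RP; rewrite preservesP; split=> H.
  move=> x y z Pxy.
  have := H (fun j (i : 'I_3) => nth o0 [:: x j; y j; z j] i).
  rewrite RP !ffunE => H'; apply: H' => j.
  by rewrite RP !ffunE; apply: Pxy.
by move=> rows Hr; rewrite RP !ffunE; apply: H => j; have := Hr j; rewrite RP !ffunE.
Qed.

Lemma preserves4 n (g : op 'I_3 n) (R : rel_on 'I_3 4)
    (P : 'I_3 -> 'I_3 -> 'I_3 -> 'I_3 -> bool) :
  (forall x, (x \in R) = P (x (@Ordinal 4 0 isT)) (x (@Ordinal 4 1 isT))
    (x (@Ordinal 4 2 isT)) (x (@Ordinal 4 3 isT))) ->
  preserves g R <-> pr4 g P.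
Proof.
move=> RP; rewrite preservesP; split=> H.
  move=> x y z u Pxy.
  have := H (fun j (i : 'I_4) => nth o0 [:: x j; y j; z j; u j] i).
  rewrite RP !ffunE => H'; apply: H' => j.
  by rewrite RP !ffunE; apply: Pxy.
by move=> rows Hr; rewrite RP !ffunE; apply: H => j; have := Hr j; rewrite RP !ffunE.
Qed.

Lemma vE m (x : {ffun 'I_m -> 'I_3}) k (km : k < m) : v x k = x (Ordinal km).
Proof.
rewrite /v (nth_map (Ordinal km)) ?size_enum_ord //.
by rewrite -[k in nth _ _ k]/(val (Ordinal km)) nth_ord_enum.
Qed.

Lemma v2E (x : {ffun 'I_2 -> 'I_3}) :
  (v x 0 = x (@Ordinal 2 0 isT)) * (v x 1 = x (@Ordinal 2 1 isT)).
Proof. by split; exact: vE. Qed.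

Lemma v4E (x : {ffun 'I_4 -> 'I_3}) :
  (v x 0 = x (@Ordinal 4 0 isT)) * (v x 1 = x (@Ordinal 4 1 isT)) *
  (v x 2 = x (@Ordinal 4 2 isT)) * (v x 3 = x (@Ordinal 4 3 isT)).
Proof. by do !split; exact: vE. Qed.

Lemma map_enum2 (F : 'I_2 -> nat) :
  [seq F i | i <- enum 'I_2] = [:: F (@Ordinal 2 0 isT); F (@Ordinal 2 1 isT)].
Proof.
rewrite !enum_ordSl (size0nil (size_enum_ord 0)) /=.
by congr [:: F _; F _]; apply/val_inj.
Qed.

Lemma map_enum3 (F : 'I_3 -> nat) : [seq F i | i <- enum 'I_3] = [:: F o0; F o1; F o2].
Proof.
rewrite !enum_ordSl (size0nil (size_enum_ord 0)) /=.
by congr [:: F _; F _; F _]; apply/val_inj.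
Qed.

Lemma mem_rel_list2 s x :
  (x \in rel_list 2 s) = relb s (x (@Ordinal 2 0 isT)) (x (@Ordinal 2 1 isT)).
Proof. by rewrite inE map_enum2. Qed.

Lemma mem_mu_ (i : 'I_3) x :
  (x \in mu_ i) = mue i (x (@Ordinal 2 0 isT)) (x (@Ordinal 2 1 isT)).
Proof. by rewrite inE !v2E. Qed.

Lemma brute4 (P Q : 'I_3 -> 'I_3 -> 'I_3 -> 'I_3 -> bool) :
  all3 (fun x => all3 (fun y => all3 (fun z => all3 (fun u => P x y z u == Q x y z u)))) ->
  forall x y z u, P x y z u = Q x y z u.
Proof. by move=> H x y z u; apply/eqP;
  apply: (all3P (all3P (all3P (all3P H x) y) z) u). Qed.

Lemma mem_Trel x : (x \in Trel) = Tb (x (@Ordinal 4 0 isT)) (x (@Ordinal 4 1 isT))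
    (x (@Ordinal 4 2 isT)) (x (@Ordinal 4 3 isT)).
Proof.
rewrite inE !v4E; move: (x _) (x _) (x _) (x _).
by apply: (brute4 (P := fun x y z u => _ == _)); vm_compute.
Qed.

Lemma mem_T'_ (i : 'I_3) x : (x \in T'_ i) = par i (x (@Ordinal 4 0 isT))
    (x (@Ordinal 4 1 isT)) (x (@Ordinal 4 2 isT)) (x (@Ordinal 4 3 isT)).
Proof.
rewrite inE !v4E; move: (x _) (x _) (x _) (x _); move: i.
by apply: I3_ind; apply: (brute4 (P := fun x y z u => [&& _, _, _ & _])); vm_compute.
Qed.

Lemma mem_T_2 x : (x \in T_ 2) = par2 (x (@Ordinal 4 0 isT)) (x (@Ordinal 4 1 isT))
    (x (@Ordinal 4 2 isT)) (x (@Ordinal 4 3 isT)).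
Proof. by rewrite inE (mem_T'_ o2) inE !v4E. Qed.

Lemma mem_Tmu2 x : (x \in Tmu2) = parmu (x (@Ordinal 4 0 isT)) (x (@Ordinal 4 1 isT))
    (x (@Ordinal 4 2 isT)) (x (@Ordinal 4 3 isT)).
Proof.
rewrite inE !v4E; move: (x _) (x _) (x _) (x _).
by apply: (brute4 (P := fun x y z u => _ == _)); vm_compute.
Qed.

Lemma mem_S01 x : (x \in S01) = S01b (x o0) (x o1) (x o2).
Proof.
rewrite inE map_enum3; move: (x _) (x _) (x _).
by do 3!apply: I3_ind; vm_compute.
Qed.

(** * Induction on the number of coordinates *)

Section Induction.
Variables (I : Type) (ar : I -> nat) (ops : forall i, op 'I_3 (ar i)).
Variables (n : nat) (f : op 'I_3 n).
Hypothesis f1 : forall P, cl1 ops P -> pr1 f P.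

Lemma prs_induction :
  (forall (K : finType) (R : (K -> 'I_3) -> Prop) (t b : K -> 'I_3) (rows : 'I_n -> K ->
    'I_3),
    clK ops R -> ~ R t -> (forall z, R (upd t z (b z))) -> (forall i, R (rows i)) ->
    t = (fun k => f [ffun i => rows i k]) -> forall j l : K, j != l -> only j l -> False) ->
  (forall (K : finType) (R : (K -> 'I_3) -> Prop) (t b : K -> 'I_3) (rows : 'I_n -> K ->
    'I_3),
    clK ops R -> ~ R t -> (forall z, R (upd t z (b z))) -> (forall i, R (rows i)) ->
    t = (fun k => f [ffun i => rows i k]) ->
    (forall K' : finType, #|K'| < #|K| ->
      forall P : (K' -> 'I_3) -> Prop, clK ops P -> prs f P) ->
    2 < #|K| -> R t) ->
  forall (K : finType) (R : (K -> 'I_3) -> Prop), clK ops R -> prs f R.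
Proof.
move=> bin step K; have [m] := ubnP #|K|; elim: m K => // m IHm K Km R clR rows Rrows.
have IH (K' : finType) : #|K'| < #|K| ->
    forall P : (K' -> 'I_3) -> Prop, clK ops P -> prs f P.
  by move=> K'K; apply: IHm; apply: leq_trans K'K _.
set t := fun k => _; have [//|nRt] := EM (R t).
have [K0|K0] := posnP #|K|.
  have tU r : r = t by apply/funext=> k; have := card0_eq K0 k; rewrite inE.
  (* With no coordinates [t] is the only tuple, so [R] is empty. A nullary operation would put [t]
     in [R], hence the empty set is a subuniverse; as [f] preserves it, there is some row, and this
     row is [t]. *)
  have cl0 : cl1 ops (fun=> False).
    move=> i x H; apply: nRt; rewrite -(tU (fun k => ops i [ffun j => t k])).
    by apply: (clR i (fun=> t)) => j; case: (H j).
  case: (f1 cl0 (x := fun=> o0)) => j; apply: nRt.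
  by rewrite -(tU (rows j)).
have /card_gt0P[z _] := K0.
have [K1|K1] := leqP #|K| 1.
  have zU k : k = z by apply: (card_le1_eqP K1).
  have rU (r : K -> 'I_3) : r = (fun=> r z) by apply/funext=> k; rewrite (zU k).
  have cl : cl1 ops (fun a => R (fun=> a)).
    by move=> i x H; apply: (clR i (fun j _ => x j)).
  by case: nRt; rewrite (rU t); apply: (f1 cl (x := fun j => rows j z)) => j; rewrite -rU.
have /choice[b Rb] : forall z, exists b, R (upd t z b) by apply: agree_off clR IH _ Rrows.
have [K2|K2] := leqP #|K| 2; last exact: (step K R t b rows).
have [l lz] : exists l, l != z.
  have : 0 < #|predC1 z| by rewrite -ltnS cardC1 prednK.
  by case/card_gt0P=> l; exists l.
exfalso; apply: (bin K R t b rows clR nRt Rb Rrows erefl l z lz) => k.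
have : k \in [set l; z].
  suff -> : [set l; z] = setT by [].
  by apply/eqP; rewrite eqEcard subsetT cardsT cards2 lz.
by rewrite !inE => /orP[]/eqP->; auto.
Qed.

End Induction.

Section Classification.
Variables (I : Type) (ar : I -> nat) (ops : forall i, op 'I_3 (ar i)).
Variable D : 'I_3 -> 'I_3 -> 'I_3 -> 'I_3.
Hypothesis D1 : forall x y, D y x x = y.
Hypothesis D2 : forall x y, D x x y = y.
Hypothesis clD : forall (K : finType) (P : (K -> 'I_3) -> Prop), clK ops P ->
  forall r1 r2 r3, P r1 -> P r2 -> P r3 -> P (fun k => D (r1 k) (r2 k) (r3 k)).

Lemma ffun_eta (T : Type) m (x : {ffun 'I_m -> T}) : [ffun k => x k] = x.
Proof. by apply/ffunP=> k; rewrite ffunE. Qed.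

Lemma clo_Pol L n (f : op 'I_3 n) : clo ops f -> Pol (Gamma_of ops L) f.
Proof.
move=> cf R [[S subS ->]|[_ invR]]; last first.
  by apply/preservesP; apply: clo_prs cf => i; apply/preservesP.
apply/preservesP; apply: clo_prs cf => i; apply/preservesP => rows Hr /=.
rewrite inE ffunE; apply: subS => k; rewrite ffunE.
by have := Hr k; rewrite inE.
Qed.

Lemma Pol_pr1 L n (f : op 'I_3 n) : Pol (Gamma_of ops L) f ->
  forall P, cl1 ops P -> pr1 f P.
Proof.
move=> Hf P clP x Px.
pose S := [set a | `[< P a >]].
have subS : subuniverse ops S.
  move=> i y Hy; rewrite inE; apply/asboolP.
  have := clP i (fun k => y k); rewrite ffun_eta; apply=> k.
  by have := Hy k; rewrite inE => /asboolP.
have HS : Gamma_of ops L (existT _ 1 (unary_rel S)) by left; exists S.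
have := proj1 (preservesP _ _) (Hf _ HS) (fun j _ => x j).
rewrite /= !inE !ffunE => H; apply/asboolP/H => j.
by rewrite !inE ffunE; apply/asboolP.
Qed.

Section Listed.
Variables (L : seq (anyrel 'I_3)) (n : nat) (f : op 'I_3 n).
Hypothesis Hf : Pol (Gamma_of ops L) f.

Lemma Pol_listed m (R : rel_on 'I_3 m) : mk R \in L -> Inv ops R -> preserves f R.
Proof.
move=> RL invR; have G : Gamma_of ops L (mk R) by right.
exact: (Hf G).
Qed.

Lemma Pol_good2 R (P : 'I_3 -> 'I_3 -> bool) : mk R \in L ->
  (forall x, (x \in R) = P (x (@Ordinal 2 0 isT)) (x (@Ordinal 2 1 isT))) ->
  good ops f P.
Proof.
move=> RL RP cP; apply/(preserves2 _ RP)/Pol_listed => // i.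
exact/(preserves2 _ RP).
Qed.

Lemma Pol_good3 R (P : 'I_3 -> 'I_3 -> 'I_3 -> bool) : mk R \in L ->
  (forall x, (x \in R) = P (x o0) (x o1) (x o2)) -> cl3 ops P -> pr3 f P.
Proof.
move=> RL RP cP; apply/(preserves3 _ RP)/Pol_listed => // i.
exact/(preserves3 _ RP).
Qed.

Lemma Pol_good4 R (P : 'I_3 -> 'I_3 -> 'I_3 -> 'I_3 -> bool) : mk R \in L ->
  (forall x, (x \in R) = P (x (@Ordinal 4 0 isT)) (x (@Ordinal 4 1 isT))
    (x (@Ordinal 4 2 isT)) (x (@Ordinal 4 3 isT))) -> cl4 ops P -> pr4 f P.
Proof.
move=> RL RP cP; apply/(preserves4 _ RP)/Pol_listed => // i.
exact/(preserves4 _ RP).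
Qed.

End Listed.

Lemma pair_ofE (x : {ffun 'I_2 -> 'I_3}) :
  x = pair_of (x (@Ordinal 2 0 isT)) (x (@Ordinal 2 1 isT)).
Proof.
apply/ffunP=> -[[|[|//]] j2]; rewrite ffunE /=; congr (x _); exact/val_inj.
Qed.

Lemma congruence_cl2 th : congruence ops th -> cl2 ops (fun x y => pair_of x y \in th).
Proof.
case=> _ _ _ Ith i.
apply/(@preserves2 _ _ th (fun x y => pair_of x y \in th)) => // x.
by rewrite {1}(pair_ofE x).
Qed.

Lemma congruence_neq_eq th : congruence ops th -> th != eq_rel 'I_3 ->
  exists x y, x <> y /\ pair_of x y \in th.
Proof.
move=> [rth _ _ _] /eqP nE; apply: contrapT => H; apply: nE; apply/setP=> x.
rewrite inE [x in x \in _]pair_ofE; have -> : ord0 = @Ordinal 2 0 isT by apply/val_inj.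
apply/idP/eqP => [xth|->]; last exact: rth.
by apply: contrapT => ne; apply: H; do 2!eexists; split; [exact: ne | exact: xth].
Qed.

(** On three elements the equivalences other than equality and the full one are the relations
    [mue e]. *)
Lemma simple_full :
  (forall e : 'I_3, ~ cl2 ops (mue e)) ->
  forall E : 'I_3 -> 'I_3 -> Prop, cl2 ops E -> (forall x, E x x) ->
  forall x y, x <> y -> E x y -> forall x' y', E x' y'.
Proof.
move=> nmu E clE rE x y xy Exy.
have sy := cl2_refl_sym D1 D2 clD clE rE; have tr := cl2_refl_trans D1 D2 clD clE rE.
have [e [/eqP ex /eqP ey]] := I3_third x y; have cov z := I3_cover z ex ey xy.
have full : E e x -> forall x' y', E x' y'.
  move=> Eex x' y'; apply: (tr _ x).
    by case: (cov x') => -> //; apply: sy.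
  by case: (cov y') => -> //; apply: sy.
have [/full//|nex] := EM (E e x).
have [Eey|ney] := EM (E e y); first by apply: full; apply: tr Eey (sy _ _ Exy).
case: (nmu e); have -> // : (fun x y => mue e x y : Prop) = E.
have [ex' ey'] := (introN eqP (nesym ex), introN eqP (nesym ey)).
apply/funext=> u; apply/funext=> w; apply/propext; rewrite /mue.
by case: (cov u) (cov w) => -> [] ->; rewrite ?eqxx ?(negbTE ex') ?(negbTE ey');
  split=> // H; solve [exact: sy | case: nex; auto | case: ney; auto].
Qed.

Lemma classification1 :
  (forall e : 'I_3, ~ cl2 ops (mue e)) ->
  (forall i : 'I_3, cl2 ops (psi_ i) -> cl2 ops (psi_ o2)) ->
  is_monolith ops (full_rel 'I_3) /\
  forall n (f : op 'I_3 n), clo ops f <-> Pol (Gamma_of ops list1) f.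
Proof.
move=> nmu psi2; have simp := simple_full nmu.
split.
  split; first by split=> *; rewrite ?inE // => i rows _; rewrite inE.
    by apply/eqP=> /setP/(_ (pair_of o0 o1)); rewrite !inE !ffunE.
  move=> th cth /(congruence_neq_eq cth)[x [y [xy th_xy]]].
  apply/subsetP=> z _; rewrite (pair_ofE z).
  by apply: (simp _ (congruence_cl2 cth) _ _ _ xy th_xy); case: cth.
move=> n f; split=> [|Hf]; first exact: clo_Pol.
have f1 := Pol_pr1 Hf.
have g_list s : mk (rel_list 2 s) \in list1 -> good ops f (relb s).
  by move=> H; apply: (Pol_good2 Hf H (mem_rel_list2 _)).
have gl s : s \in binlist1 -> good ops f (relb s).
  have E : list1 = [seq mk (rel_list 2 s) | s <- binlist1] ++
    [:: mk Trel; mk (T'_ 0); mk (T'_ 1); mk (T'_ 2)] by [].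
  move=> sl; apply: g_list; rewrite E mem_cat; apply/orP; left.
  exact: (map_f (fun s => mk (rel_list 2 s)) sl).
have f_par i : cl4 ops (par i) -> pr4 f (par i).
  apply: (Pol_good4 Hf _ (mem_T'_ i)).
  by case: (I3_cases i) => ->; rewrite !inE ?eqxx ?orbT.
have f_Tb : cl4 ops Tb -> pr4 f Tb.
  by apply: (Pol_good4 Hf _ mem_Trel); rewrite !inE ?eqxx ?orbT.
apply: clo_of_prs; apply: prs_induction => //.
- move=> K R t b rows clR nRt Rb Rrows tE.
  apply: (simple_binary D1 D2 clD clR nRt Rb Rrows tE simp).
    by move=> *; apply: good_pair.
  by move=> p pI; apply: good_perm => //; apply: psi2.
move=> K R t b rows clR nRt Rb Rrows tE IH K3.
exact: (simple_step D1 D2 clD clR nRt Rb Rrows tE IH K3 simp).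
Qed.

Lemma classification2 : cl2 ops mu ->
  is_monolith ops (mu_ 2) /\
  forall n (f : op 'I_3 n), clo ops f <-> Pol (Gamma_of ops list2) f.
Proof.
move=> clmu; have mem_mu x := mem_mu_ o2 x.
have muE a b : (pair_of a b \in mu_ 2) = mu a b by rewrite mem_mu !ffunE.
split.
  split.
  - split=> [a|a b|a b c|i]; rewrite ?muE /mu //.
    + by rewrite eq_sym.
    + by move/eqP->.
    + exact/(preserves2 _ mem_mu).
  - apply/eqP=> /setP/(_ (pair_of o0 o1)); by rewrite muE !inE !ffunE.
  move=> th cth /(congruence_neq_eq cth)[x [y [xy th_xy]]].
  have [rth sth _ _] := cth.
  have th01 : pair_of o0 o1 \in th.
    exact: (mu_least D1 D2 clD clmu (congruence_cl2 cth) rth xy th_xy).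
  apply/subsetP=> z; rewrite (pair_ofE z) muE.
  move: (z (@Ordinal 2 0 isT)) (z (@Ordinal 2 1 isT)) => u w.
  by case: (I3_cases u) (I3_cases w) => -> [] -> // _; auto.
move=> n f; split=> [|Hf]; first exact: clo_Pol.
have f1 := Pol_pr1 Hf.
have g_mu : good ops f mu by apply: (Pol_good2 Hf _ mem_mu); rewrite !inE ?eqxx ?orbT.
have g_list s : mk (rel_list 2 s) \in list2 -> good ops f (relb s).
  by move=> H; apply: (Pol_good2 Hf H (mem_rel_list2 _)).
have g_rho : good ops f (fun x y => ~~ mu x y).
  apply: (Pol_good2 Hf (R := rho_ 2)); first by rewrite !inE ?eqxx ?orbT.
  by move=> x; rewrite inE mem_mu.
have [[g0 g1] [g2 g2']] : (good ops f (relb tau0l) /\ good ops f (relb tau1l)) /\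
    (good ops f (relb psi2l) /\ good ops f (relb psi2l')).
  by do !split; apply: g_list; rewrite !inE eqxx ?orbT.
have f_par : cl4 ops (par o2) -> pr4 f (par o2).
  by apply: (Pol_good4 Hf _ (mem_T'_ o2)); rewrite !inE ?eqxx ?orbT.
have f_par2 : cl4 ops par2 -> pr4 f par2.
  by apply: (Pol_good4 Hf _ mem_T_2); rewrite !inE ?eqxx ?orbT.
have f_parmu : cl4 ops parmu -> pr4 f parmu.
  by apply: (Pol_good4 Hf _ mem_Tmu2); rewrite !inE ?eqxx ?orbT.
have f_S01 : cl3 ops S01b -> pr3 f S01b.
  by apply: (Pol_good3 Hf _ mem_S01); rewrite !inE ?eqxx ?orbT.
apply: clo_of_prs; apply: prs_induction => //.
- move=> K R t b rows clR nRt Rb Rrows tE.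
  exact: (mu_binary D1 D2 clD f1 clR nRt Rb Rrows tE clmu g_mu g_rho g0 g1 g2 g2').
move=> K R t b rows clR nRt Rb Rrows tE IH K3.
exact: (mu_step D1 D2 clD clR nRt Rb Rrows tE IH K3 clmu (g_mu clmu)).
Qed.

End Classification.

Lemma card3_bij (B : finType) (e : B) : #|B| = 3 ->
  exists2 h : B -> 'I_3, bijective h & h e = o2.
Proof.
move=> B3; pose h0 x := cast_ord B3 (enum_rank x).
exists (fun x => tperm (h0 e) o2 (h0 x)); last by rewrite tpermL.
apply: inj_card_bij; last by rewrite card_ord B3.
by move=> x y /perm_inj/cast_ord_inj/enum_rank_inj.
Qed.

(** * Transport along a labelling by {0,1,2} *)

Section Transport.
Variables (B : finType) (I : Type) (ar : I -> nat) (opsB : forall i, op B (ar i)).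
Variables (h : B -> 'I_3) (g : 'I_3 -> B).
Hypotheses (hK : cancel h g) (gK : cancel g h).

Definition tops i : op 'I_3 (ar i) :=
  [ffun x : {ffun 'I_(ar i) -> 'I_3} => h (opsB i [ffun k => g (x k)])].

Lemma topsE i (x : 'I_(ar i) -> B) :
  tops i [ffun k => h (x k)] = h (opsB i [ffun k => x k]).
Proof.
by rewrite ffunE; congr (h (opsB i _)); apply/ffunP=> k; rewrite !ffunE hK.
Qed.

Lemma cl2_pull P : cl2 tops P -> cl2 opsB (fun x y => P (h x) (h y)).
Proof.
by move=> cP i x y H; rewrite -!topsE; apply: (cP i (h \o x) (h \o y)).
Qed.

Lemma cl2_push P : cl2 opsB P -> cl2 tops (fun x y => P (g x) (g y)).
Proof.
move=> cP i x y H.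
have gE z : g (tops i [ffun k => z k]) = opsB i [ffun k => g (z k)].
  rewrite ffunE hK; congr (opsB i _); apply/ffunP=> k; by rewrite !ffunE.
by rewrite !gE; apply: (cP i (g \o x) (g \o y)).
Qed.

Lemma mue_push e : cl2 opsB (mue e) -> cl2 tops (mue (h e)).
Proof.
move/cl2_push; congr cl2; apply/funext=> x; apply/funext=> y.
by rewrite /mue !(can2_eq gK hK).
Qed.

Lemma mue_pull i : cl2 tops (mue i) -> cl2 opsB (mue (g i)).
Proof.
move/cl2_pull; congr cl2; apply/funext=> x; apply/funext=> y.
by rewrite /mue !(can2_eq hK gK).
Qed.

Lemma psi_push e : cl2 opsB (psi_ e) -> cl2 tops (psi_ (h e)).
Proof.
move/cl2_push; congr cl2; apply/funext=> x; apply/funext=> y.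
by rewrite /psi_ !(can2_eq gK hK) // gK.
Qed.

Lemma psi_pull i : cl2 tops (psi_ i) -> cl2 opsB (psi_ (g i)).
Proof.
move/cl2_pull; congr cl2; apply/funext=> x; apply/funext=> y.
by rewrite /psi_ !(can2_eq hK gK) // hK.
Qed.

Variable d : op B 3.
Hypothesis clod : clo opsB d.

Definition tD a b c := h (d (triple_of (g a) (g b) (g c))).

Lemma clK_tD (K : finType) (P : (K -> 'I_3) -> Prop) : clK tops P ->
  forall r1 r2 r3, P r1 -> P r2 -> P r3 -> P (fun k => tD (r1 k) (r2 k) (r3 k)).
Proof.
move=> cP r1 r2 r3 P1 P2 P3.
have cP' : clK opsB (fun r : K -> B => P (h \o r)).
  move=> i rows Hr; have := cP i (fun j => h \o rows j) Hr; congr P.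
  by apply/funext=> k /=; rewrite -topsE.
have hg r : P r -> P (h \o (g \o r)).
  by congr P; apply/funext=> k /=; rewrite gK.
exact: (clo_malcev clod cP' (hg _ P1) (hg _ P2) (hg _ P3)).
Qed.

End Transport.

Theorem theorem4p8 (B : finType) (I : Type) (ar : I -> nat)
    (opsB : forall i, op B (ar i)) :
  #|B| = 3 -> malcev opsB ->
  exists (opsA : forall i, op 'I_3 (ar i)) (h : B -> 'I_3),
    [/\ bijective h,
        (forall i (x : {ffun 'I_(ar i) -> B}),
            h (opsB i x) = opsA i [ffun k => h (x k)]) &
        (is_monolith opsA (full_rel 'I_3) /\
           forall n (f : op 'I_3 n), clo opsA f <-> Pol (Gamma_of opsA list1) f)
        \/
        (is_monolith opsA (mu_ 2) /\
           forall n (f : op 'I_3 n), clo opsA f <-> Pol (Gamma_of opsA list2) f)].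
Proof.
move=> B3 [d clod dE].
have transport e : exists h : B -> 'I_3, exists g, [/\ cancel h g, cancel g h & h e = o2].
  by have [h [g hK gK] he] := card3_bij e B3; exists h, g.
have D1 (h : B -> 'I_3) g : cancel g h -> forall x y, tD h g d y x x = y.
  by move=> gK x y; rewrite /tD (proj1 (dE _ _)) gK.
have D2 (h : B -> 'I_3) g : cancel g h -> forall x y, tD h g d x x y = y.
  by move=> gK x y; rewrite /tD (proj2 (dE _ _)) gK.
have hom (h : B -> 'I_3) g : cancel h g -> forall i (x : {ffun 'I_(ar i) -> B}),
    h (opsB i x) = tops opsB h g i [ffun k => h (x k)].
  by move=> hK i x; rewrite topsE // ffun_eta.
(* The labelling sends to 2 the singleton class of an invariant [mue e], if there is one. *)
have [[e clmu]|nmu] := EM (exists e, cl2 opsB (mue e)).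
  have [h [g [hK gK he]]] := transport e.
  exists (tops opsB h g), h; split; [by exists g | exact: hom | right].
  apply: (classification2 (D1 h g gK) (D2 h g gK) (clK_tD hK gK clod)).
  by have := mue_push hK gK clmu; rewrite he.
(* Otherwise the point labelled 2 is one fixed by an invariant transposition, or arbitrary if none
   is invariant; this is the condition on [psi_] that [classification1] asks for. *)
have [e He] : exists e : B, forall i, cl2 opsB (psi_ i) -> cl2 opsB (psi_ e).
  have [[e cle]|nps] := EM (exists e, cl2 opsB (psi_ e)); first by exists e.
  have /card_gt0P[e _] : 0 < #|B| by rewrite B3.
  by exists e => i cli; case: nps; exists i.
have [h [g [hK gK he]]] := transport e.
exists (tops opsB h g), h; split; [by exists g | exact: hom | left].
apply: (classification1 (D1 h g gK) (D2 h g gK) (clK_tD hK gK clod)).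
  by move=> i /(mue_pull hK gK) H; apply: nmu; exists (g i).
move=> i /(psi_pull hK gK)/He/(psi_push hK gK).
by rewrite he.
Qed.
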